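(* Let $p$ be a prime and let $G$ be a generalized Baumslag-Solitar tree group, presented by a finite labeled tree $T$ with vertex groups $\langle x_v\rangle$, $v\in V(T)$. For every pair of distinct vertices $u,v$ of $T$, let $S_{(u,v)}\subseteq\langle x_u,x_v\rangle$ be the set attached to the pair of vertex groups $\langle x_u\rangle,\langle x_v\rangle$ as described in the context, and let $S=\bigcup_{u\ne v}S_{(u,v)}$. Then $(N_p)_\omega(G)$ is the normal closure of $S$ in $G$.
   Context: Commutators are $[a,b]=a^{-1}b^{-1}ab$. For a group $G$ and a prime $p$, $(N_p)_\omega(G)$ denotes the intersection of all normal subgroups of $G$ whose index is finite and a power of $p$. GBS tree group: let $T$ be a finite tree in which each edge $e$ with endpoints $u,v$ carries two nonzero integer labels, $\lambda_{e,u}$ (at $u$) and $\lambda_{e,v}$ (at $v$). The associated group is $G=\langle x_v\ (v\in V(T)) \mid x_u^{\lambda_{e,u}}=x_v^{\lambda_{e,v}}\ \text{for every edge } e=\{u,v\}\rangle$; it is the fundamental group of the corresponding tree of infinite cyclic groups. The vertex groups $\langle x_v\rangle$ are infinite cyclic subgroups of $G$, and any two of them intersect in a nontrivial subgroup. The sets $S_{(u,v)}$: for distinct vertices $u,v$ write $a=x_u$, $b=x_v$, and let $k,l$ be nonzero integers with $a^k=b^l$ and $\langle a\rangle\cap\langle b\rangle=\langle a^k\rangle=\langle b^l\rangle$. Write $k=p^{\kappa}k_1$, $l=p^{\lambda}l_1$ with $\kappa,\lambda\ge 0$ and $p\nmid k_1$, $p\nmid l_1$, and let $d_1=\gcd(k_1,l_1)$.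 Then $$S_{(u,v)}=\{a^{k/d_1}b^{-l/d_1},\ [a,b^{p^{\lambda}}],\ [a^{p^{\kappa}},b]\}.$$ *)

(* Defs.v *)
From HB Require Import structures.
From mathcomp Require Import all_boot all_algebra.
From mathcomp Require Import all_classical.

Set Implicit Arguments.
Unset Strict Implicit.
Unset Printing Implicit Defensive.

Local Open Scope classical_set_scope.
Local Open Scope group_scope.

(** * Groups given by generators and relations *)

(* The letter (x, false) stands for x and (x, true) for its inverse. *)
Definition word (X : Type) : Type := seq (X * bool).

Definition inv_word (X : Type) (w : word X) : word X :=
  rev [seq (a.1, ~~ a.2) | a <- w].

Definition gen_pow (X : Type) (x : X) (m : int) : word X :=
  nseq `|m|%N (x, (m < 0)%R).

(* The congruence on words generated by free cancellation and by the
   relations r.1 = r.2, for r in R. *)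
Inductive word_cong (X : Type) (R : set (word X * word X)) :
    word X -> word X -> Prop :=
| Wrefl w : word_cong R w w
| Wsym w1 w2 : word_cong R w1 w2 -> word_cong R w2 w1
| Wtrans w1 w2 w3 : word_cong R w1 w2 -> word_cong R w2 w3 -> word_cong R w1 w3
| Wcancel s t x b : word_cong R (s ++ [:: (x, b); (x, ~~ b)] ++ t) (s ++ t)
| Wrel s t r : R r -> word_cong R (s ++ r.1 ++ t) (s ++ r.2 ++ t).

Section Presentation.
Variables (X : choiceType) (R : set (word X * word X)).
Implicit Types w : word X.

Definition word_congb : rel (word X) := fun w1 w2 => `[< word_cong R w1 w2 >].

Lemma word_congb_refl : reflexive word_congb.
Proof. by move=> w; apply/asboolP; exact: Wrefl. Qed.

Lemma word_congb_sym : symmetric word_congb.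
Proof.
by move=> w1 w2; apply/asboolP/asboolP => ?; exact: Wsym.
Qed.

Lemma word_congb_trans : transitive word_congb.
Proof.
move=> w2 w1 w3 /asboolP h12 /asboolP h23; apply/asboolP.
exact: Wtrans h12 h23.
Qed.

Canonical word_cong_equiv :=
  EquivRel word_congb word_congb_refl word_congb_sym word_congb_trans.

Lemma word_cong_cat w1 w2 s t :
  word_cong R w1 w2 -> word_cong R (s ++ w1 ++ t) (s ++ w2 ++ t).
Proof.
elim=> [w|u v _|u v w _ huv _ hvw|u v x b|u v r Rr].
- exact: Wrefl.
- exact: Wsym.
- exact: Wtrans huv hvw.
- have := @Wcancel _ R (s ++ u) (v ++ t) x b.
  by rewrite -!catA.
- have := @Wrel _ R (s ++ u) (v ++ t) r Rr.
  by rewrite -!catA.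
Qed.

Lemma word_cong_mulVw w : word_cong R (inv_word w ++ w) [::].
Proof.
elim: w => [|[x b] w IHw]; first exact: Wrefl.
rewrite /inv_word /= rev_cons cat_rcons.
apply: (Wtrans _ IHw).
by have := @Wcancel _ R (inv_word w) w x (~~ b); rewrite negbK.
Qed.

Lemma inv_wordK : involutive (@inv_word X).
Proof.
move=> w; rewrite /inv_word map_rev revK -map_comp.
by rewrite (eq_map (g := id)) ?map_id // => -[x b] /=; rewrite negbK.
Qed.

Lemma word_cong_mulwV w : word_cong R (w ++ inv_word w) [::].
Proof. by rewrite -{1}(inv_wordK w); exact: word_cong_mulVw. Qed.

Lemma word_cong_mul u u' v v' :
  word_cong R u u' -> word_cong R v v' -> word_cong R (u ++ v) (u' ++ v').
Proof.
move=> hu hv; apply: (@Wtrans _ _ _ (u' ++ v)).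
  exact: (word_cong_cat [::] v hu).
by have := word_cong_cat u' [::] hv; rewrite !cats0.
Qed.

Lemma word_cong_inv u v :
  word_cong R u v -> word_cong R (inv_word u) (inv_word v).
Proof.
move=> h; apply: (@Wtrans _ _ _ (inv_word u ++ (v ++ inv_word v))).
  rewrite -{1}(cats0 (inv_word u)); apply: word_cong_mul; first exact: Wrefl.
  exact/Wsym/word_cong_mulwV.
rewrite catA -[X in word_cong _ _ X]cat0s.
apply: word_cong_mul; last exact: Wrefl.
apply: (Wtrans _ (word_cong_mulVw u)).
by apply: word_cong_mul; [exact: Wrefl | exact: Wsym].
Qed.

Definition presented : Type := {eq_quot word_cong_equiv}%qT.
HB.instance Definition _ := Choice.on presented.
HB.instance Definition _ := EqQuotient.on presented.

Definition of_word w : presented := (\pi_presented w)%qT.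

Lemma of_wordP w1 w2 : of_word w1 = of_word w2 <-> word_cong R w1 w2.
Proof. by split=> [/eqmodP/asboolP|h]; last exact/eqmodP/asboolP. Qed.

Lemma of_word_repr (g : presented) : of_word (repr g) = g.
Proof. exact: reprK. Qed.

Lemma repr_of_word w : word_cong R (repr (of_word w)) w.
Proof. by apply/of_wordP; rewrite of_word_repr. Qed.

Definition pres_one : presented := of_word [::].
Definition pres_mul (g h : presented) : presented :=
  of_word (repr g ++ repr h).
Definition pres_inv (g : presented) : presented := of_word (inv_word (repr g)).

Lemma pres_mulE w1 w2 : pres_mul (of_word w1) (of_word w2) = of_word (w1 ++ w2).
Proof. by apply/of_wordP; apply: word_cong_mul; exact: repr_of_word. Qed.

Lemma pres_invE w : pres_inv (of_word w) = of_word (inv_word w).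
Proof. by apply/of_wordP; apply: word_cong_inv; exact: repr_of_word. Qed.

Lemma pres_mulA : associative pres_mul.
Proof.
move=> f g h; rewrite -(of_word_repr f) -(of_word_repr g) -(of_word_repr h).
by rewrite !pres_mulE catA.
Qed.

Lemma pres_mul1g : left_id pres_one pres_mul.
Proof. by move=> g; rewrite -(of_word_repr g) pres_mulE. Qed.

Lemma pres_mulg1 : right_id pres_one pres_mul.
Proof. by move=> g; rewrite -(of_word_repr g) pres_mulE cats0. Qed.

Lemma pres_mulVg : left_inverse pres_one pres_inv pres_mul.
Proof.
move=> g; rewrite -(of_word_repr g) pres_invE pres_mulE.
exact/of_wordP/word_cong_mulVw.
Qed.

Lemma pres_mulgV : right_inverse pres_one pres_inv pres_mul.
Proof.
move=> g; rewrite -(of_word_repr g) pres_invE pres_mulE.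
exact/of_wordP/word_cong_mulwV.
Qed.

HB.instance Definition _ := isGroup.Build presented
  pres_mulA pres_mul1g pres_mulg1 pres_mulVg pres_mulgV.

Definition pres_gen (x : X) : presented := of_word [:: (x, false)].

End Presentation.

(** * Subgroups and residuals of arbitrary groups *)

Section Groups.
Variable G : groupType.
Implicit Types (x a b : G) (N S : set G).

Definition expgz x (m : int) : G :=
  match m with Posz n => x ^+ n | Negz n => x ^- n.+1 end.

Definition cyclic_subgroup x : set G := range (expgz x).

Definition normal_subgroup N : Prop :=
  [/\ N 1,
      (forall x y, N x -> N y -> N (x * y)),
      (forall x, N x -> N x^-1)
    & (forall x y, N x -> N (x ^ y))].

Definition normal_closure S : set G :=
  \bigcap_(N in [set N | normal_subgroup N /\ S `<=` N]) N.

Definition left_cosets N : set (set G) :=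
  range (fun g => [set g * n | n in N]).

Definition has_index N (n : nat) : Prop := (left_cosets N #= `I_n)%card.

Definition Np_omega (p : nat) : set G :=
  \bigcap_(N in [set N | normal_subgroup N /\
                         exists n : nat, has_index N (p ^ n)%N]) N.

(* The exponents (k, l) are determined by (a, b) up to a common sign. *)
Definition meet_exponents a b (k l : int) : Prop :=
  [/\ k <> 0%R, l <> 0%R, expgz a k = expgz b l,
      cyclic_subgroup a `&` cyclic_subgroup b = cyclic_subgroup (expgz a k)
    & cyclic_subgroup a `&` cyclic_subgroup b = cyclic_subgroup (expgz b l)].

Definition S_pair (p : nat) a b (k l : int) : set G :=
  let kappa := logn p `|k|%N in
  let lambda := logn p `|l|%N in
  let k1 := (k %/ (p ^ kappa)%N%:Z)%Z in
  let l1 := (l %/ (p ^ lambda)%N%:Z)%Z in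
  let d1 := gcdz k1 l1 in
  [set expgz a (k %/ d1)%Z * expgz b (- (l %/ d1)%Z)%R;
       [~ a, b ^+ (p ^ lambda)];
       [~ a ^+ (p ^ kappa), b] ].

End Groups.

(** * Generalized Baumslag-Solitar tree groups *)

Definition is_tree (V : finType) (e : rel V) : Prop :=
  [/\ (0 < #|V|)%N, symmetric e, irreflexive e,
      (forall u v, connect e u v)
    & (forall c : seq V, (2 < size c)%N -> ~ ucycle e c)].

(* lab u v is the label, at its end u, of the edge {u, v}. *)
Definition gbs_relations (V : finType) (e : rel V) (lab : V -> V -> int) :
    set (word V * word V) :=
  [set r | exists u v, e u v /\
     r = (gen_pow u (lab u v), gen_pow v (lab v u))].

Definition gbs_group (V : finType) (e : rel V) (lab : V -> V -> int) :
    groupType :=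
  presented (gbs_relations e lab).

Definition gbs_gen (V : finType) (e : rel V) (lab : V -> V -> int) (v : V) :
    gbs_group e lab :=
  pres_gen (gbs_relations e lab) v.

(* Main.v *)
From HB Require Import structures.
Require Import Defs.
From mathcomp Require Import all_fingroup all_solvable.
From mathcomp Require Import all_boot all_order all_algebra.
From mathcomp Require Import zify ring.
From mathcomp Require Import all_classical.

(* Weights q_v = p^rho_v m_v, with p not dividing m_v, such that x_v |-> q_v is
   a homomorphism to Z exist because T is a tree.  In Q = G / <<S>> the relations
   S provide elements y_v with y_v^m_v = x_v satisfying the edge relations in
   which every label is replaced by its p-part; so Q is a tree group all of whose
   labels are powers of p, and it remains to separate its elements from 1 by
   finite p-groups.  For a syllable y_v^n put h = rho_v + log_p n, and let
   T(v, n) be the component of v in the forest of edges whose amalgamated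
   subgroup has weight of p-adic valuation at most h.  Every element of Q is a
   product of syllables in which consecutive components T are disjoint.  Such a
   word is detected by a Magnus-type representation over F_p: the i-th syllable
   contributes a segment of length p^h_i to a path, and y_u maps to 1 + X_u,
   where X_u moves forward by p^rho_u along those segments with u in T_i.  As
   adjacent segments have disjoint components, no factor of the word crosses a
   segment boundary, so the entry from the start to the end of the path is a
   product of binomial coefficients prime to p. *)

Set Implicit Arguments.
Unset Strict Implicit.
Unset Printing Implicit Defensive.

Import Order.TTheory GRing.Theory Num.Theory.
Local Open Scope classical_set_scope.
Local Open Scope group_scope.

Notation "{ 'ghom' G -> H }" := (UMagmaMorphism.type G H)
  (G at level 98, H at level 99) : type_scope.

(** * Powers of group elements with integer exponents *)

Section IntegerPowers.
Variable G : groupType.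
Implicit Types (x y : G) (m n : int).

Lemma expgzB_nat x (a b : nat) : expgz x (a%:Z - b%:Z)%R = x ^+ a * x ^- b.
Proof.
have [le_ba|lt_ab] := leqP b a.
  by rewrite subzn //= expgnFr.
have -> : (a%:Z - b%:Z)%R = Negz (b - a).-1 by lia.
rewrite /= prednK ?subn_gt0 // expgnFr 1?ltnW // invgF //.
Qed.

Lemma int_subnatP n : exists a b : nat, n = (a%:Z - b%:Z)%R.
Proof.
case: n => n; first by exists n, 0; rewrite subr0.
by exists 0, n.+1; rewrite NegzE sub0r.
Qed.

Lemma expgz0 x : expgz x 0%R = 1. Proof. by []. Qed.

Lemma expgz1 x : expgz x 1%R = x. Proof. by []. Qed.

Lemma commute_expgz x y m : commute x y -> commute x (expgz y m).
Proof.
by case: m => n cxy /=; [exact: commuteX | exact/commuteV/commuteX].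
Qed.

Lemma expgzD x m n : expgz x (m + n)%R = expgz x m * expgz x n.
Proof.
have [a [b ->]] := int_subnatP m; have [c [d ->]] := int_subnatP n.
have -> : (a%:Z - b%:Z + (c%:Z - d%:Z) = (a + c)%N%:Z - (d + b)%N%:Z)%R by lia.
rewrite !expgzB_nat !expgnDr invgM -!mulgA; congr (_ * _).
rewrite !mulgA; congr (_ * _).
by apply: commuteV; apply: commuteX2; apply: commute_refl.
Qed.

Lemma expgzN x m : expgz x (- m)%R = (expgz x m)^-1.
Proof.
by apply/esym/mulg1_eq; rewrite -expgzD subrr.
Qed.

Lemma expgzM x m n : expgz x (m * n)%R = expgz (expgz x m) n.
Proof.
have posM (k : nat) : expgz x (m * k%:Z)%R = expgz x m ^+ k.
  elim: k => [|k IHk]; first by rewrite mulr0.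
  by rewrite -addn1 PoszD mulrDr mulr1 expgzD IHk addn1 expgSr.
case: n => k /=; first exact: posM.
by rewrite NegzE mulrN expgzN posM.
Qed.

Lemma expgzX x (a : nat) m : expgz (x ^+ a) m = expgz x (a%:Z * m)%R.
Proof. by rewrite expgzM. Qed.

Lemma expgzXr x (a : nat) m : expgz x m ^+ a = expgz x (m * a%:Z)%R.
Proof. by rewrite expgzM. Qed.

Lemma expgzXC x (a : nat) m : expgz (x ^+ a) m = expgz x m ^+ a.
Proof. by rewrite expgzX mulrC -expgzXr. Qed.

Lemma expgz1g m : expgz (1 : G) m = 1.
Proof. by case: m => n /=; rewrite expg1n // invg1. Qed.

Lemma expgMz x y m : commute x y -> expgz (x * y) m = expgz x m * expgz y m.
Proof.
move=> cxy; case: m => n /=; first by rewrite expgMn.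
rewrite expgMn // invgM.
apply: commute_sym; apply: commuteV; apply: commute_sym; apply: commuteV.
exact: commuteX2.
Qed.

Lemma expgVz x m : expgz x^-1 m = (expgz x m)^-1.
Proof.
apply/esym/mulg1_eq; rewrite -expgMz ?mulgV ?expgz1g //.
exact/commuteV/commute_refl.
Qed.

Lemma prime_pow_torsion_coprime (p e : nat) x m : prime p -> ~~ (p %| `|m|)%N ->
  x ^+ (p ^ e) = 1 -> expgz x m = 1 -> x = 1.
Proof.
move=> p_pr pNm xpe xm.
have cop : coprimez (p ^ e)%N%:Z m.
  by rewrite coprimezE /= coprimeXl // prime_coprime.
have [[u v]] := coprimezP _ _ cop; rewrite /= => uv.
rewrite -(expgz1 x) -uv expgzD ![(_ * _%:Z)%R]mulrC [(_ * m)%R]mulrC !expgzM.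
by rewrite xm /= xpe !expgz1g mulg1.
Qed.

(** An inverse s of m modulo p^e recovers an element of order dividing p^e from its m-th power. *)
Lemma prime_pow_root_unique (p e : nat) x y m : prime p -> ~~ (p %| `|m|)%N ->
  x ^+ (p ^ e) = 1 -> y ^+ (p ^ e) = 1 -> expgz x m = expgz y m -> x = y.
Proof.
move=> p_pr pNm xpe ype eq_m.
have : coprimez m (p ^ e)%N%:Z.
  by rewrite coprimezE coprime_sym coprimeXl // prime_coprime.
case/coprimezP=> -[s t] /= st.
have root (z : G) : z ^+ (p ^ e) = 1 -> z = expgz (expgz z m) s.
  move=> zpe; rewrite -{1}(expgz1 z) -st expgzD [(s * _)%R]mulrC [(t * _)%R]mulrC.
  by rewrite !expgzM /= zpe expgz1g mulg1.
by rewrite (root x) // eq_m -root.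
Qed.

End IntegerPowers.

Lemma gmulf_expgz (G H : groupType) (f : {ghom G -> H}) x m :
  f (expgz x m) = expgz (f x) m.
Proof. by case: m => n /=; rewrite ?gmulfV gmulfXn. Qed.

(** * Homomorphisms out of presented groups, and quotient groups *)

Section Universal.
Variables (X : choiceType) (R : set (word X * word X)).
Variables (H : groupType) (f : X -> H).

Definition eval_word (w : word X) : H :=
  \prod_(a <- w) (if a.2 then (f a.1)^-1 else f a.1).

Lemma eval_word_cat u w : eval_word (u ++ w) = eval_word u * eval_word w.
Proof. exact: big_cat. Qed.

Lemma eval_word_inv w : eval_word (inv_word w) = (eval_word w)^-1.
Proof.
elim: w => [|[x b] w IHw]; first by rewrite /eval_word !big_nil invg1.
rewrite /inv_word /= rev_cons -cats1 eval_word_cat IHw.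
rewrite [eval_word (_ :: w)](eval_word_cat [:: _]) invgM /eval_word !big_seq1 /=.
by case: b => //=; rewrite invgK.
Qed.

Lemma eval_gen_pow x m : eval_word (gen_pow x m) = expgz (f x) m.
Proof.
rewrite /eval_word /gen_pow; rewrite big_nseq iter_mulg_1.
by case: m => n //=; rewrite expVgn.
Qed.

Lemma eval_word_cong (f_rel : forall r, R r -> eval_word r.1 = eval_word r.2)
  w1 w2 : word_cong R w1 w2 -> eval_word w1 = eval_word w2.
Proof.
elim=> [//|//|u v w _ -> _ -> //|u v x b|u v r Rr]; rewrite !eval_word_cat.
  congr (_ * _); rewrite -[RHS]mul1g; congr (_ * _).
  by rewrite /eval_word !big_cons big_nil mulg1; case: b => /=; rewrite ?mulVg ?mulgV.
by rewrite f_rel.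
Qed.

Lemma pres_hom (f_rel : forall r, R r -> eval_word r.1 = eval_word r.2) :
  exists phi : {ghom presented R -> H},
    forall w, phi (of_word R w) = eval_word w.
Proof.
pose phi (g : presented R) := eval_word (repr g).
have phiE w : phi (of_word R w) = eval_word w.
  exact/(eval_word_cong f_rel)/repr_of_word.
have phiF : {morph phi : x y / x / y}.
  move=> x y; rewrite -[x]of_word_repr -[y]of_word_repr.
  rewrite [(of_word R (repr y))^-1]pres_invE [_ * _]pres_mulE !phiE.
  by rewrite eval_word_cat eval_word_inv.
pose phiM := isGroupMorphism.Build (presented R) H phi phiF.
pose psi : {ghom presented R -> H} := HB.pack phi phiM.
by exists psi.
Qed.

End Universal.

Lemma of_word_eval (X : choiceType) (R : set (word X * word X)) (w : word X) :
  eval_word (fun x => pres_gen R x) w = of_word R w.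
Proof.
elim: w => [|[x b] w IHw]; first exact: big_nil.
rewrite (eval_word_cat _ [:: _]) IHw /eval_word big_seq1 /=.
case: b; last exact: pres_mulE.
by rewrite [(pres_gen R x)^-1]pres_invE [LHS]pres_mulE.
Qed.

Lemma eval_word_morph (X : choiceType) (G H : groupType)
    (phi : {ghom G -> H}) (f : X -> G) w :
  phi (eval_word f w) = eval_word (phi \o f) w.
Proof.
rewrite /eval_word gmulf_prod; apply: eq_bigr => -[x b] _ /=.
by case: b; rewrite // gmulfV.
Qed.

Lemma of_word_gen_pow (X : choiceType) (R : set (word X * word X)) (x : X) m :
  of_word R (gen_pow x m) = expgz (pres_gen R x) m.
Proof. by rewrite -of_word_eval eval_gen_pow. Qed.

(* The quotient is presented by all elements of G, with the relations that
   hold modulo N. *)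
Lemma quotient_exists (G : groupType) (N : set G) : normal_subgroup N ->
  exists (Q : groupType) (pi : {ghom G -> Q}),
    (forall g, pi g = 1 <-> N g) /\ (forall q, exists g, pi g = q).
Proof.
move=> [N1 NM NV NJ].
pose ev : word G -> G := @eval_word G G id.
pose R : set (word G * word G) := [set r | N ((ev r.1)^-1 * ev r.2)].
(* Congruent words evaluate into one left coset of [N]; this keeps the kernel of [pi] inside [N]. *)
have cong_ev w1 w2 : word_cong R w1 w2 -> N ((ev w1)^-1 * ev w2).
  elim=> [w|u v _|u v w _ huv _ hvw|u v x b|u v r Rr]; first by rewrite mulVg.
  - by move=> /NV; rewrite invgM invgK.
  - by have := NM _ _ huv hvw; rewrite mulgA mulgK.
  - suff -> : ev (u ++ [:: (x, b); (x, ~~ b)] ++ v) = ev (u ++ v).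
      by rewrite mulVg.
    rewrite /ev !eval_word_cat; congr (_ * _); rewrite -[RHS]mul1g.
    congr (_ * _); rewrite /eval_word !big_cons big_nil mulg1.
    by case: b => /=; rewrite ?mulVg ?mulgV.
  - rewrite /ev !eval_word_cat !invgM !mulgA mulgVK.
    by have := NJ _ (ev v) Rr; rewrite /conjg !mulgA.
pose pi (g : G) : presented R := pres_gen R g.
have piM : {morph pi : x y / x * y}.
  move=> x y; apply: esym; rewrite [LHS]pres_mulE; apply/of_wordP.
  have := @Wrel _ R [::] [::] ([:: (x, false); (y, false)], [:: (x * y, false)]).
  by apply; rewrite /R /= /ev /eval_word !big_cons !big_nil /= !mulg1 mulVg.
have pi1 : pi 1 = 1 by apply: (@mulgI _ (pi 1)); rewrite -piM !mulg1.
have piF : {morph pi : x y / x / y}.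
  move=> x y; rewrite piM; congr (_ * _).
  by apply/esym/mulg1_eq; rewrite -piM mulgV.
pose pi' : {ghom G -> presented R} :=
  HB.pack pi (isGroupMorphism.Build G (presented R) pi piF).
exists (presented R), pi'; split=> [g|q].
  split=> [|Ng].
    move/of_wordP/Wsym/cong_ev.
    by rewrite /ev /eval_word big_seq1 big_nil invg1 mul1g.
  apply/of_wordP/Wsym.
  have := @Wrel _ R [::] [::] ([::], [:: (g, false)]).
  by apply; rewrite /R /= /ev /eval_word big_seq1 big_nil invg1 mul1g.
exists (ev (repr q)).
rewrite -[RHS]of_word_repr -of_word_eval /ev.
by rewrite (eval_word_morph pi').
Qed.

Lemma factor_through (G Q H : groupType) (pi : {ghom G -> Q})
    (phi : {ghom G -> H}) :
  (forall q, exists g, pi g = q) -> (forall g, pi g = 1 -> phi g = 1) ->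
  exists psi : {ghom Q -> H}, forall g, psi (pi g) = phi g.
Proof.
move=> pi_surj ker_phi.
pose psi q := phi (projT1 (cid (pi_surj q))).
have psiE g : psi (pi g) = phi g.
  rewrite /psi; case: cid => h /= eq_hg; apply: divg1_eq.
  by rewrite -gmulfF ker_phi // gmulfF eq_hg mulgV.
have psiF : {morph psi : x y / x / y}.
  move=> x y; have [g <-] := pi_surj x; have [h <-] := pi_surj y.
  by rewrite -gmulfF !psiE gmulfF.
pose psi' : {ghom Q -> H} :=
  HB.pack psi (isGroupMorphism.Build Q H psi psiF).
by exists psi'.
Qed.

(** * Normal subgroups of p-power index *)

(** The bijection transports a finite group structure to [Q], so that Lagrange's theorem applies. *)
Lemma bij_expg (Q : groupType) n (f : Q -> 'I_n) :
  bijective f -> forall x : Q, x ^+ n = 1.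
Proof.
move=> bij_f x; have [g fK gK] := bij_f.
pose QC : countType := HB.pack Q (CanIsCountable fK).
pose QF : finType := HB.pack Q (CanIsCountable fK) (@CanIsFinite QC 'I_n f g fK).
pose QG : finGroupType := HB.pack Q (Finite.class QF) (Group.class Q).
have cardQ : #|[set: QG]%G| = n.
  by rewrite cardsT -[RHS]card_ord; exact: (@bij_eq_card QG _ f bij_f).
by rewrite -cardQ; apply: (@expg_cardG QG [set: QG]%G x); rewrite inE.
Qed.

(** A labelling constant exactly on left cosets is easier to build and to use than a bijection with
    the set of all cosets. *)
Lemma has_indexP (G : groupType) (N : set G) n : normal_subgroup N ->
  has_index N n <-> exists f : G -> 'I_n,
    (forall g h, f g = f h <-> N (g^-1 * h)) /\ (forall i, exists g, f g = i).
Proof.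
move=> [N1 NM NV _]; pose coset g : set G := [set g * x | x in N].
have cosetP g h : coset g = coset h <-> N (g^-1 * h).
  split=> [eq_gh|Ngh].
    have [x Nx <-] : coset g h by rewrite eq_gh; exists 1; rewrite ?mulg1.
    by rewrite mulKg.
  have Nhg : N (h^-1 * g) by rewrite -[_ * g]invgK invgM invgK; apply: NV.
  apply/seteqP; split=> _ [x Nx <-].
    by exists (h^-1 * g * x); [apply: NM | rewrite -mulgA mulVKg].
  by exists (g^-1 * h * x); [apply: NM | rewrite -mulgA mulVKg].
split=> [/card_set_bijP[f [f_fun f_inj f_surj]]|[f [fP f_surj]]].
  have f_lt g : (f (coset g) < n)%N by apply: f_fun; exists g.
  exists (fun g => Ordinal (f_lt g)); split=> [g h|i].
    rewrite -cosetP; split=> [[]|/(congr1 f) eq_f]; last exact: val_inj.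
    by apply: f_inj; rewrite inE; [exists g | exists h].
  have [_ [g _ <-] eq_i] := f_surj i (ltn_ord i).
  by exists g; apply: val_inj.
pose rep i := projT1 (cid (f_surj i)).
have repK i : f (rep i) = i by rewrite /rep; case: cid.
rewrite /has_index.
have -> : left_cosets N = (coset \o rep) @` [set: 'I_n].
  apply/seteqP; split=> [_ [g _ <-]|_ [i _ <-]]; last by exists (rep i).
  by exists (f g) => //=; apply/cosetP/fP; rewrite repK.
apply: card_eq_trans (card_esym card_II).
apply: inj_card_eq => i j _ _ /cosetP/fP.
by rewrite !repK.
Qed.

Lemma expg_index (G : groupType) (N : set G) n : normal_subgroup N ->
  has_index N n -> forall g, N (g ^+ n).
Proof.
move=> nN /(has_indexP _ nN)[f [fP f_surj]] g.
have [Q [pi [piP pi_surj]]] := quotient_exists nN.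
pose lift q := projT1 (cid (pi_surj q)).
have liftK q : pi (lift q) = q by rewrite /lift; case: cid.
have fE x y : f x = f y <-> pi x = pi y.
  rewrite fP -piP gmulfM gmulfV.
  by split=> [/mulg1_eq|->]; rewrite ?mulVg ?invgK.
have bij_f : bijective (f \o lift).
  pose rep i := projT1 (cid (f_surj i)).
  have repK i : f (rep i) = i by rewrite /rep; case: cid.
  exists (pi \o rep) => [q|i] /=.
    by rewrite -[RHS]liftK; apply/fE; rewrite repK.
  by rewrite -[RHS]repK; apply/fE; rewrite liftK.
by apply/piP; rewrite gmulfXn; exact: bij_expg bij_f _.
Qed.

Lemma hom_kernel_normal (G H : groupType) (phi : {ghom G -> H}) :
  normal_subgroup [set g | phi g = 1].
Proof.
split=> [|x y|x|x y] /=; first exact: gmulf1.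
- by rewrite gmulfM => -> ->; rewrite mulg1.
- by rewrite gmulfV => ->; rewrite invg1.
- by rewrite gmulfJ => ->; rewrite conj1g.
Qed.

(** The image of [phi] is a finite group whose elements have p-power order, hence a p-group by
    Cauchy's theorem, and its order is the index of the kernel. *)
Lemma ker_p_index (p : nat) (G : groupType) (H : finGroupType)
    (phi : {ghom G -> H}) : prime p ->
    (forall g, exists e, phi g ^+ (p ^ e) = 1) ->
  exists n, has_index [set g | phi g = 1] (p ^ n)%N.
Proof.
move=> p_pr phi_p.
pose I : {set H} := [set x | `[< exists g, phi g = x >]]%SET.
have IE g : phi g \in I by rewrite finset.in_set; apply/asboolP; exists g.
have IP x : x \in I -> exists g, phi g = x by rewrite finset.in_set => /asboolP.
have gI : group_set I.
  apply/group_setP; split; first by have := IE 1; rewrite gmulf1.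
  by move=> x y /IP[g <-] /IP[h <-]; rewrite -gmulfM; apply: IE.
have : p.-group (group gI).
  apply/pgroupP => q q_pr /(Cauchy q_pr)[x /IP[g <-] ordq].
  have [e] := phi_p g; move/eqP; rewrite -order_dvdn ordq.
  by rewrite Euclid_dvdX // dvdn_prime2 // => /andP[/eqP-> _]; rewrite inE /=.
move=> /p_natP[n cardI]; exists n.
rewrite -cardI; apply/has_indexP; first exact: hom_kernel_normal.
exists (fun g => enum_rank_in (IE 1) (phi g)); split=> [g h|i].
  split=> [/(congr1 enum_val)|/=].
    rewrite !enum_rankK_in // => eq_gh.
    by rewrite /= gmulfM gmulfV eq_gh mulVg.
  by rewrite gmulfM gmulfV => /mulg1_eq; rewrite invgK => ->.
have [g eq_g] := IP _ (enum_valP i).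
by exists g; rewrite eq_g enum_valK_in.
Qed.

(** * The relations S_(u,v) *)

Lemma p_part_split (p : nat) (k : int) : prime p -> k != 0%R ->
  exists2 k1, k = ((p ^ logn p `|k|)%N%:Z * k1)%R & ~~ (p %| `|k1|)%N.
Proof.
move=> p_pr k0; have absk0 : (0 < `|k|)%N by lia.
have [n pNn eq_k] := pfactor_coprime p_pr absk0.
exists (sgz k * n%:Z)%R.
  by rewrite [LHS]intEsg {1}eq_k PoszM mulrA mulrC.
have -> : `|(sgz k * n%:Z)%R|%N = n by case: sgzP k0 => //; lia.
by rewrite -prime_coprime.
Qed.

Lemma coprime_absz_gcd (p : nat) (k l : int) :
  ~~ (p %| `|k|)%N -> ~~ (p %| `|gcdz k l|)%N.
Proof. by apply: contra => /dvdn_trans; apply; rewrite dvdn_gcdl. Qed.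

(* The weights p^ru mu and p^rv mv are the images of the two generators under
   a homomorphism to Z. *)
Lemma pair_arith (p ru rv : nat) (mu mv k l : int) :
    prime p -> k != 0%R -> l != 0%R ->
    ~~ (p %| `|mu|)%N -> ~~ (p %| `|mv|)%N ->
    ((p ^ ru)%N%:Z * mu * k = (p ^ rv)%N%:Z * mv * l)%R ->
  let kappa := logn p `|k| in let lambda := logn p `|l| in
  let d := gcdz (k %/ (p ^ kappa)%N%:Z)%Z (l %/ (p ^ lambda)%N%:Z)%Z in
  exists k' l' g : int,
    [/\ (ru + kappa = rv + lambda)%N /\ ~~ (p %| `|d|)%N,
        (k %/ d)%Z = ((p ^ kappa)%N%:Z * k')%R /\ (k' * (p ^ kappa)%N%:Z * d)%R = k,
        (l %/ d)%Z = ((p ^ lambda)%N%:Z * l')%R /\ (l' * (p ^ lambda)%N%:Z * d)%R = l,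
        mu = (l' * g)%R
      & mv = (k' * g)%R].
Proof.
move=> p_pr k0 l0 pNmu pNmv eq_kl kappa lambda d.
have [k1 eq_k pNk1] := p_part_split p_pr k0.
have [l1 eq_l pNl1] := p_part_split p_pr l0.
rewrite -/kappa in eq_k; rewrite -/lambda in eq_l.
have pX0 e : ((p ^ e)%N%:Z != 0)%R by rewrite eqz_nat -lt0n expn_gt0 prime_gt0.
have dE : d = gcdz k1 l1 by rewrite /d {1}eq_k {1}eq_l !mulKz.
clearbody d.
have k10 : k1 != 0%R by apply: contraNneq pNk1 => ->.
have d0 : d != 0%R by rewrite dE gcdz_eq0 negb_and k10.
have logX e (n : int) : ~~ (p %| `|n|)%N ->
    logn p `|((p ^ e)%N%:Z * n)%R|%N = e.
  move=> pNn; have n0 : (0 < `|n|)%N by rewrite lt0n; apply: contraNneq pNn => ->.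
  rewrite abszM lognM // ?expn_gt0 ?prime_gt0 //.
  by rewrite pfactorK // lognE (negPf pNn) !andbF addn0.
have pNM (a b : int) : ~~ (p %| `|a|)%N -> ~~ (p %| `|b|)%N -> ~~ (p %| `|(a * b)%R|)%N.
  by move=> pa pb; rewrite abszM Euclid_dvdM // negb_or pa.
have eq1 : ((p ^ (ru + kappa))%N%:Z * (mu * k1) = (p ^ (rv + lambda))%N%:Z * (mv * l1))%R.
  move: eq_kl; rewrite eq_k eq_l !expnD !PoszM => eq_kl.
  by rewrite mulrACA eq_kl mulrACA.
(* Taking p-adic valuations separates the p-part of the equation from the part prime to p. *)
have eq_e : (ru + kappa = rv + lambda)%N.
  move/(congr1 (fun n : int => logn p `|n|)): eq1.
  by rewrite !logX ?pNM.
have eq_m : (mu * k1 = mv * l1)%R by move: eq1; rewrite eq_e; apply: mulfI.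
have dk : (d %| k1)%Z by rewrite dE dvdz_gcdl.
have dl : (d %| l1)%Z by rewrite dE dvdz_gcdr.
pose k' := (k1 %/ d)%Z; pose l' := (l1 %/ d)%Z.
have eq_k' : k1 = (k' * d)%R by rewrite divzK.
have eq_l' : l1 = (l' * d)%R by rewrite divzK.
have eq_m' : (mu * k' = mv * l')%R.
  by apply: (mulIf d0); rewrite -!mulrA -eq_k' -eq_l'.
have cop : coprimez k' l'.
  have [u [v uv]] := Bezoutz k1 l1.
  apply/coprimezP; exists (u, v) => /=; apply: (mulIf d0).
  by rewrite mul1r mulrDl -!mulrA -eq_k' -eq_l' uv.
(* As k' and l' are coprime, l' divides mu; the quotient g is then also the cofactor of k' in mv. *)
have [g eq_mu] : exists g : int, (mu = l' * g)%R.
  have : (l' %| (mu * k')%R)%Z by rewrite eq_m' dvdz_mull.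
  rewrite Gauss_dvdzl; last by rewrite coprimez_sym.
  by move/dvdzP=> [g ->]; exists g; rewrite mulrC.
exists k', l', g; split.
- by split=> //; rewrite dE; apply: coprime_absz_gcd.
- have ek : k = ((p ^ kappa)%N%:Z * k' * d)%R by rewrite [LHS]eq_k eq_k' mulrA.
  by rewrite [(k' * _)%R]mulrC -ek; split=> //; rewrite [in LHS]ek mulzK.
- have el : l = ((p ^ lambda)%N%:Z * l' * d)%R by rewrite [LHS]eq_l eq_l' mulrA.
  by rewrite [(l' * _)%R]mulrC -el; split=> //; rewrite [in LHS]el mulzK.
- by [].
- have l'0 : l' != 0%R by apply: contraNneq pNl1 => l'0; rewrite eq_l' l'0 mul0r.
  apply: (mulIf l'0); rewrite -eq_m' eq_mu.
  by rewrite [(k' * _)%R]mulrC [(l' * g)%R]mulrC mulrAC.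
Qed.

Section PairSets.
Variables (p : nat) (H : groupType).
Implicit Types (a b : H) (k l : int).

Lemma S_pair_image (G : groupType) (phi : {ghom G -> H}) (x y : G) k l :
  S_pair p (phi x) (phi y) k l = phi @` S_pair p x y k l.
Proof.
rewrite /S_pair !image_setU !image_set1 !gmulfR gmulfM.
by rewrite !gmulf_expgz !gmulfXn.
Qed.

Lemma S_pair_sub1P a b k l :
  let kappa := logn p `|k| in let lambda := logn p `|l| in
  let d := gcdz (k %/ (p ^ kappa)%N%:Z)%Z (l %/ (p ^ lambda)%N%:Z)%Z in
  S_pair p a b k l `<=` [set 1] <->
  [/\ expgz a (k %/ d)%Z = expgz b (l %/ d)%Z,
      commute a (b ^+ (p ^ lambda)) & commute (a ^+ (p ^ kappa)) b].
Proof.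
split=> [S1|[eq_ab cab cba] g].
  split.
  - by apply: divg1_eq; rewrite -expgzN; apply: S1; left; left.
  - by apply/commgP/eqP; apply: S1; left; right.
  - by apply/commgP/eqP; apply: S1; right.
case=> [[->|->]|->] /=.
- by rewrite eq_ab expgzN mulgV.
- exact/eqP/commgP.
- exact/eqP/commgP.
Qed.

(** With k = p^kappa k1, the exponent k1 is invertible modulo p^n, so a^(p^kappa) is a power of a^k
    = b^l. *)
Lemma commute_p_part a b k l n : prime p -> k != 0%R -> expgz a k = expgz b l ->
  a ^+ (p ^ n) = 1 -> commute (a ^+ (p ^ logn p `|k|)) b.
Proof.
move=> p_pr k0 eq_ab a1; have [k1 eq_k pNk1] := p_part_split p_pr k0.
have : coprimez k1 (p ^ n)%N%:Z.
  by rewrite coprimezE coprime_sym coprimeXl // prime_coprime.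
case/coprimezP=> -[u v] /= uv.
set A := a ^+ _.
have Ak : expgz A k1 = expgz b l by rewrite expgzX -eq_k.
have A1 : expgz A (p ^ n)%N = 1 by rewrite /= expgnAC a1 expg1n.
rewrite -[A]expgz1 -uv expgzD [(u * _)%R]mulrC [(v * _)%R]mulrC !expgzM Ak A1.
rewrite expgz1g mulg1 -expgzM.
exact/commute_sym/commute_expgz/commute_refl.
Qed.

(* In exponent p^n the subgroups generated by a^k and by the p-part of the
   exponent coincide, since the p'-part of k is invertible modulo p^n. *)
Lemma S_pair_p_torsion a b k l ru rv mu mv n :
    prime p -> k != 0%R -> l != 0%R ->
    ~~ (p %| `|mu|)%N -> ~~ (p %| `|mv|)%N ->
    ((p ^ ru)%N%:Z * mu * k = (p ^ rv)%N%:Z * mv * l)%R ->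
  expgz a k = expgz b l -> (forall x : H, x ^+ (p ^ n) = 1) ->
  S_pair p a b k l `<=` [set 1].
Proof.
move=> p_pr k0 l0 pNmu pNmv eq_kl eq_ab H1; apply/S_pair_sub1P.
have cab := commute_p_part p_pr k0 eq_ab (H1 a).
have cba := commute_p_part p_pr l0 (esym eq_ab) (H1 b).
split; [|exact: commute_sym cba|exact: cab].
have [k' [l' [g [[_ pNd] [-> ek] [-> el] _ _]]]] :=
  pair_arith p_pr k0 l0 pNmu pNmv eq_kl.
set d := gcdz _ _ in pNd ek el *.
rewrite -!expgzX; set A := expgz _ k'; set B := expgz _ l'.
have cAB : commute A B.
  apply: commute_expgz; apply: commuteX; apply: commute_sym; apply: commute_expgz.
  exact: commute_sym.
apply: divg1_eq; apply: (prime_pow_torsion_coprime p_pr pNd (H1 _)).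
rewrite expgMz; last exact: commuteV.
rewrite expgVz /A /B -!expgzM !expgzX.
by rewrite mulrCA mulrA ek mulrCA mulrA el eq_ab mulgV.
Qed.
End PairSets.

(** * Extraction of roots of order prime to p *)

Section Roots.
Variables (p : nat) (p_pr : prime p) (V : finType) (Q : groupType) (x : V -> Q).
Variables (rho : V -> nat) (m c : V -> int) (k l : V -> V -> int).
Hypothesis pNm : forall v, ~~ (p %| `|m v|)%N.
Hypothesis bezout_m : (\sum_v c v * m v = 1)%R.
Hypothesis k_neq0 : forall u v, u != v -> k u v != 0%R.
Hypothesis l_neq0 : forall u v, u != v -> l u v != 0%R.
Hypothesis weight_kl : forall u v, u != v ->
  ((p ^ rho u)%N%:Z * m u * k u v = (p ^ rho v)%N%:Z * m v * l u v)%R.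
Hypothesis S1 : forall u v, u != v ->
  S_pair p (x u) (x v) (k u v) (l u v) `<=` [set 1].

(* A high p-power z_v of x_v is central, the pair relations make the z_v powers
   of one element z with z_v = z^m_v, and x_v, z generate a cyclic group in
   which the generator y_v is found by Bezout. *)
Lemma p_roots : exists y : V -> Q, (forall v, expgz (y v) (m v) = x v) /\
  forall u v, u != v -> y u ^+ (p ^ logn p `|k u v|) = y v ^+ (p ^ logn p `|l u v|).
Proof.
(* p^M bounds the p-parts of the weights of all pairwise intersections, so each [z v] lies deep
   enough to be central. The diagonal terms are arbitrary but harmless, and ensure that [rho v] is
   at most M. *)
pose M := \max_u \max_v (rho u + logn p `|k u v|).
have leM u v : rho u + logn p `|k u v| <= M.
  apply: (@leq_trans (\max_v (rho u + logn p `|k u v|))).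
    exact: (leq_bigmax (F := fun w => rho u + logn p `|k u w|)).
  exact: (leq_bigmax (F := fun w => \max_v (rho w + logn p `|k w v|))).
pose z v := x v ^+ (p ^ (M - rho v)).
have pairP u v : u != v -> exists (k' l' : int),
  [/\ rho u + logn p `|k u v| = rho v + logn p `|l u v|,
      expgz (x u ^+ (p ^ logn p `|k u v|)) k' = expgz (x v ^+ (p ^ logn p `|l u v|)) l',
      (m u * k' = m v * l')%R /\ ~~ (p %| `|(m u * k')%R|)%N,
      commute (x u) (x v ^+ (p ^ logn p `|l u v|))
    & commute (x u ^+ (p ^ logn p `|k u v|)) (x v)] /\
   exists g : int, (m u = l' * g)%R /\ (m v = k' * g)%R.
  move=> uv.
  have [k' [l' [g [[eq_e _] [ek _] [el _] mu mv]]]] :=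
    pair_arith p_pr (k_neq0 uv) (l_neq0 uv) (pNm u) (pNm v) (weight_kl uv).
  have /S_pair_sub1P[eq_uv cuv cvu] := S1 uv.
  exists k', l'; split; last by exists g.
  split=> //; first by rewrite !expgzX -ek -el.
  split; first by rewrite mu mv mulrAC [RHS]mulrAC [(l' * k')%R]mulrC.
  rewrite abszM Euclid_dvdM // negb_or pNm /=.
  by move: (pNm v); rewrite mv abszM Euclid_dvdM // negb_or => /andP[].
have cxz u v : commute (x u) (z v).
  have [->|uv] := eqVneq u v; first exact/commuteX/commute_refl.
  have [k' [l' [[eq_e _ _ cuv _] _]]] := pairP _ _ uv.
  rewrite /z (_ : M - rho v = logn p `|l u v| + (M - (rho v + logn p `|l u v|)))%N.
    by rewrite expnD expgnA; exact: commuteX.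
  by have := leM u v; lia.
have zz u v : expgz (z u) (m v) = expgz (z v) (m u).
  have [->//|uv] := eqVneq u v.
  have [k' [l' [[eq_e eq_x _ _ _] [g [-> ->]]]]] := pairP _ _ uv.
  rewrite !expgzM; congr expgz.
  have eu : (M - rho u = logn p `|k u v| + (M - (rho u + logn p `|k u v|)))%N.
    by have := leM u v; lia.
  have ev : (M - rho v = logn p `|l u v| + (M - (rho u + logn p `|k u v|)))%N.
    by have := leM u v; lia.
  rewrite /z eu ev !expnD !expgnA.
  set U := x u ^+ _ in eq_x *; set W := x v ^+ _ in eq_x *.
  by rewrite expgzX mulrC -expgzXr eq_x expgzXr mulrC -expgzX.
have czz u v : commute (z u) (z v).
  exact/commute_sym/commuteX/commute_sym/cxz.
(* By [zz], the m_u-th power of Z is the product of the z_u^(c_v m_v), which is z_u by the Bezout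
   identity. *)
pose Z := \prod_v expgz (z v) (c v).
have cxZ u : commute (x u) Z.
  by apply: commute_prod => v _; exact: commute_expgz.
have Zm u : expgz Z (m u) = z u.
  rewrite -[RHS]expgz1 -bezout_m /Z.
  elim: (index_enum V) => [|v s IHs]; first by rewrite !big_nil expgz1g.
  rewrite !big_cons expgMz; last first.
    apply: commute_sym; apply: commute_expgz; apply: commute_sym.
    by apply: commute_prod => w _; exact: commute_expgz.
  by rewrite IHs expgzD -expgzM ![(c v * _)%R]mulrC !expgzM zz.
have cst u s t : commute (expgz (x u) s) (expgz Z t).
  by apply/commute_expgz/commute_sym/commute_expgz/commute_sym.
have /choice[y yP] u : exists yu : Q,
    [/\ expgz yu (m u) = x u, yu ^+ (p ^ (M - rho u)) = Z
      & exists s t : int, yu = expgz (x u) s * expgz Z t].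
  have : coprimez (m u) (p ^ (M - rho u))%N%:Z.
    by rewrite coprimezE coprime_sym coprimeXl // prime_coprime.
  case/coprimezP=> -[s t] /= st.
  (* The wanted y_u has x_u and Z as its powers of exponents m_u and p^(M - rho_u); Bezout for these
     two exponents dictates the formula. *)
  exists (expgz (x u) s * expgz Z t); split; last by exists s, t.
    rewrite expgMz // -!expgzM [(t * _)%R]mulrC [expgz Z (_ * _)%R]expgzM Zm /z expgzX -expgzD.
    by rewrite [(_%:Z * t)%R]mulrC st.
  rewrite expgMn // !expgzXr [(s * _)%R]mulrC -expgzX -/(z u) -Zm -expgzM -expgzD.
  by rewrite mulrC st.
exists y; split=> [u|u v uv]; first by have [] := yP u.
have [k' [l' [[eq_e eq_x [eq_m pNmk] cuv cvu] _]]] := pairP _ _ uv.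
have [yu yuZ [s [t eq_yu]]] := yP u; have [yv yvZ [s' [t' eq_yv]]] := yP v.
set U := y u ^+ _; set W := y v ^+ _.
(* Both are products of a power of Z, which commutes with everything here, and a power of
   x_u^(p^kappa) or x_v^(p^lambda); the latter two commute by the relators in S. *)
have cUW : commute U W.
  rewrite /U /W eq_yu eq_yv !expgMn; try exact: cst.
  rewrite -!expgzXC.
  have cX (a b : Q) (i j : nat) (r r' : int) :
      commute a b -> commute (expgz (a ^+ i) r) (expgz (b ^+ j) r').
    move=> cab; apply/commute_expgz/commuteX/commute_sym.
    exact/commute_expgz/commuteX/commute_sym.
  apply: commuteM; apply: commute_sym; apply: commuteM; apply: commute_sym.
  - apply/commute_expgz/commuteX/commute_sym/commute_expgz/commute_sym.
    exact: cvu.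
  - exact/cX/commute_sym/cxZ.
  - exact/cX/cxZ.
  - exact/cX/commute_refl.
(* The element U W^-1 is killed by a power of p, since both sides reach Z, and by m_u k' = m_v l',
   since the pair relation then holds. These exponents are coprime. *)
apply: divg1_eq.
apply: (@prime_pow_torsion_coprime _ p (M - (rho u + logn p `|k u v|)) _ (m u * k')%R) => //.
  rewrite expgnFl // /U /W -!expgnA -!expnD.
  rewrite [(_ + (M - _))%N](_ : _ = M - rho u)%N; last by have := leM u v; lia.
  rewrite [(_ + (M - _))%N](_ : _ = M - rho v)%N; last by have := leM u v; lia.
  by rewrite yuZ yvZ mulgV.
rewrite expgMz ?expgVz; last exact: commuteV.
apply/eqP; rewrite mulg_eq1 invgK; apply/eqP.
rewrite {2}eq_m !expgzM /U /W ![expgz (y _ ^+ _) _]expgzXC.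
by rewrite yu yv.
Qed.
End Roots.

(** * Weights on a tree *)

Section TreeWeights.
Variables (V : finType) (e : rel V) (lab : V -> V -> int).
Hypothesis tree_e : is_tree e.
Hypothesis lab_neq0 : forall u v, e u v -> lab u v <> 0%R.

Definition induced (A : {set V}) : rel V :=
  fun u v => [&& e u v, u \in A & v \in A].

(** Two distinct neighbours of v in A would be joined by a simple path inside A, which v closes to a
    cycle of length at least three. *)
Lemma unique_attachment (A : {set V}) (u w v : V) :
  (forall a b, a \in A -> b \in A -> connect (induced A) a b) ->
  u \in A -> w \in A -> v \notin A -> e u v -> e w v -> u = w.
Proof.
move=> connA uA wA vA euv ewv; case: tree_e => _ e_sym _ _ acyclic.
apply/eqP/negPn/negP => uw.
have /connectP[s s_path] := connA u w uA wA.
case: (shortenP s_path) => s' s'_path s'_uniq _ w_last.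
have s'A : all (mem A) s'.
  elim: (s') (u) s'_path => //= a q IHq b /andP[/and3P[_ _ ->]] /IHq.
  by [].
have s'_e : path e u s'.
  by apply: sub_path s'_path => a b /and3P[].
apply: (acyclic (v :: u :: s')).
  by case: (s') w_last => //= eq_wu; rewrite eq_wu eqxx in uw.
apply/andP; split; last first.
  rewrite cons_uniq s'_uniq andbT inE negb_or.
  apply/andP; split; first by apply: contraNneq vA => ->.
  by apply: contraNN vA => /(allP s'A).
by rewrite /= rcons_path s'_e -w_last e_sym euv ewv.
Qed.

(** A connected vertex set grows by one vertex at a time; the new vertex is attached by a single
    edge, so only one equation has to be satisfied. *)
Lemma tree_weights : exists q : V -> int,
  (forall v, q v != 0%R) /\
  (forall u v, e u v -> (q u * lab u v = q v * lab v u)%R).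
Proof.
have [V0 e_sym e_irr conn_e _] := tree_e.
have [r _] := card_gt0P V0.
suff step n : n.+1 <= #|V| -> exists (A : {set V}) (q : V -> int),
    [/\ #|A| = n.+1, forall a b, a \in A -> b \in A -> connect (induced A) a b,
        forall v, q v != 0%R
      & forall u v, u \in A -> v \in A -> e u v -> (q u * lab u v = q v * lab v u)%R].
  have [|A [q [cardA _ q0 eq_q]]] := step #|V|.-1; first by rewrite prednK.
  have AT v : v \in A.
    have [_] := subset_leqif_cards (finset.subsetT A).
    rewrite cardsT cardA prednK // eqxx => /esym/eqP->.
    by rewrite finset.in_setT.
  by exists q; split=> // u v; apply: eq_q.
elim: n => [_|n IHn lt_n].
  exists [set r]%SET, (fun=> 1%R); split=> //; first by rewrite cards1.
    by move=> a b; rewrite !finset.in_set1 => /eqP-> /eqP->.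
  by move=> u v; rewrite !finset.in_set1 => /eqP-> /eqP->; rewrite e_irr.
have [A [q [cardA connA q0 eq_q]]] := IHn (ltnW lt_n).
have [u [v [uA vA euv]]] : exists u v, [/\ u \in A, v \notin A & e u v].
  have [a aA] : exists a, a \in A by apply/card_gt0P; rewrite cardA.
  have [b bA] : exists b, b \notin A.
    apply/existsP; rewrite -negb_forall; apply/negP => /forallP AT.
    have : #|A| = #|V| by apply: eq_card => x; rewrite AT.
    by rewrite cardA => eqn; rewrite eqn ltnn in lt_n.
  have /connectP[s s_path b_last] := conn_e a b.
  elim: s a aA s_path b_last => [|c s IHs] a aA /=.
    by move=> _ eq_ba; rewrite eq_ba aA in bA.
  case/andP=> eac s_path b_last; have [cA|cA] := boolP (c \in A).
    exact: IHs cA s_path b_last.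
  by exists a, c.
(* Scaling the old weights by [lab v u] keeps the weight of the new vertex v integral. *)
pose q' w := if w == v then (q u * lab u v)%R else (q w * lab v u)%R.
have evu : e v u by rewrite e_sym.
exists (v |: A)%SET, q'; split.
- by rewrite cardsU1 vA cardA.
- have subA a b : connect (induced A) a b -> connect (induced (v |: A)%SET) a b.
    apply: connect_sub => {}a {}b /and3P[eab aA bA]; apply: connect1.
    by rewrite /induced eab !finset.in_setU1 aA bA !orbT.
  have cuv : connect (induced (v |: A)%SET) u v.
    by apply: connect1; rewrite /induced euv !finset.in_setU1 uA eqxx orbT.
  have cvu : connect (induced (v |: A)%SET) v u.
    by apply: connect1; rewrite /induced evu !finset.in_setU1 uA eqxx orbT.
  move=> a b; rewrite !finset.in_setU1 => /predU1P[->|aA] /predU1P[->|bA] //.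
  + exact: connect_trans cvu (subA _ _ (connA _ _ uA bA)).
  + exact: connect_trans (subA _ _ (connA _ _ aA uA)) cuv.
  + exact/subA/connA.
- move=> w; rewrite /q'; case: ifP => _; rewrite mulf_neq0 ?q0 //; apply/eqP.
    exact: lab_neq0.
  exact: lab_neq0.
- have attach w : w \in A -> e w v -> w = u.
    by move=> wA ewv; exact: unique_attachment connA wA uA vA ewv euv.
  move=> a b; rewrite !finset.in_setU1 /q'.
  case: (eqVneq a v) => [->|av] /=; case: (eqVneq b v) => [->|bv] //=.
  + by move=> _ bA evb; rewrite (attach b bA) 1?e_sym // mulrAC.
  + by move=> aA _ eav; rewrite (attach a aA eav) mulrAC.
  + by move=> aA bA eab; rewrite mulrAC eq_q // mulrAC.
Qed.

End TreeWeights.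

(** Here d is the gcd of the family, obtained by folding Bezout's identity over an enumeration of
    V. *)
Lemma family_bezout (V : finType) (q : V -> int) (v0 : V) : q v0 != 0%R ->
  exists (d : int) (q' c : V -> int),
    [/\ d != 0%R, forall v, q v = (q' v * d)%R & (\sum_v c v * q' v = 1)%R].
Proof.
move=> q0.
have gcd_seq (s : seq V) : exists (d : int) (c : V -> int),
    (forall v, v \in s -> (d %| q v)%Z) /\ (\sum_v c v * q v = d)%R.
  elim: s => [|v s [d [c [dP cd]]]].
    by exists 0%R, (fun=> 0%R); split=> //; apply: big1 => v _; rewrite mul0r.
  have [a [b ab]] := Bezoutz (q v) d.
  exists (gcdz (q v) d), (fun w => (a * (w == v)%:Z + b * c w)%R); split.
    move=> w; rewrite inE => /predU1P[->|/dP]; first exact: dvdz_gcdl.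
    exact/dvdz_trans/dvdz_gcdr.
  rewrite -ab -cd mulr_sumr -[X in (X + _)%R](_ : (\sum_w (w == v)%:Z * (a * q w))%R = _).
    by rewrite -big_split; apply: eq_bigr => w _ /=; lia.
  rewrite (bigD1 v) //= eqxx mul1r big1 ?addr0 // => w /negPf->.
  by rewrite mul0r.
have [d [c [dP cd]]] := gcd_seq (enum V).
have d0 : d != 0%R.
  by apply: contraNneq q0 => d0; have := dP v0; rewrite mem_enum d0 dvd0z => /(_ isT).
have eq_q v : q v = ((q v %/ d)%Z * d)%R by rewrite divzK // dP ?mem_enum.
exists d, (fun v => (q v %/ d)%Z), c; split=> //.
apply: (mulIf d0); rewrite mul1r mulr_suml -[RHS]cd.
by apply: eq_bigr => v _; rewrite -mulrA -eq_q.
Qed.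

(** After division by the gcd, each weight splits into p^rho and a part m prime to p; absorbing
    p^rho into the coefficient turns the Bezout identity of the weights into one for m. *)
Lemma gbs_weights (p : nat) (V : finType) (e : rel V) (lab : V -> V -> int) :
    prime p -> is_tree e -> (forall u v, e u v -> lab u v <> 0%R) ->
  exists (rho : V -> nat) (m c : V -> int),
    [/\ forall v, ~~ (p %| `|m v|)%N, (\sum_v c v * m v = 1)%R
      & forall u v, e u v ->
        ((p ^ rho u)%N%:Z * m u * lab u v = (p ^ rho v)%N%:Z * m v * lab v u)%R].
Proof.
move=> p_pr tree_e lab0; have [q [q0 eq_q]] := tree_weights tree_e lab0.
have [V0 _ _ _ _] := tree_e; have [r _] := card_gt0P V0.
have [d [q' [c [d0 eq_q' c1]]]] := family_bezout (q0 r).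
have q'0 v : q' v != 0%R.
  by apply: contraNneq (q0 v) => q'v0; rewrite eq_q' q'v0 mul0r.
have /choice[m mP] v : exists n : int,
    (q' v = (p ^ logn p `|q' v|)%N%:Z * n)%R /\ ~~ (p %| `|n|)%N.
  by have [n] := p_part_split p_pr (q'0 v); exists n.
exists (fun v => logn p `|q' v|), m, (fun v => c v * (p ^ logn p `|q' v|)%N%:Z)%R.
split=> [v||u v euv]; first by have [] := mP v.
  by rewrite -[RHS]c1; apply: eq_bigr => v _; have [{2}-> _] := mP v; rewrite mulrA.
have [<- _] := mP u; have [<- _] := mP v; apply: (mulIf d0).
by rewrite ![(_ * lab _ _ * d)%R]mulrAC -!eq_q' eq_q.
Qed.

(** * Reduced words *)

Section Levels.
Variables (p : nat) (V : finType) (e : rel V) (rho : V -> nat) (K : V -> V -> nat).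
Hypothesis p_pr : prime p.
Hypothesis e_sym : symmetric e.
Hypothesis rhoK : forall u v, e u v -> (rho u + K u v = rho v + K v u)%N.

(** With [K u v] the exponent of p in the label at u, [rho u + K u v] is the valuation of the weight
    of the amalgamated subgroup of the edge. *)
Definition level_edge (h : nat) : rel V :=
  fun u v => e u v && (rho u + K u v <= h)%N.

(** The valuation of the weight of the syllable; the exponent 0, for which [logn] returns 0, is
    excluded from reduced words. *)
Definition level (a : V * int) : nat := (rho a.1 + logn p `|a.2|)%N.

(** Since components grow with the level, this says that the components of the two syllables, each
    taken at its own level, are disjoint. *)
Definition separated (a b : V * int) : bool :=
  ~~ connect (level_edge (maxn (level a) (level b))) a.1 b.1.

Definition reduced (s : seq (V * int)) : bool :=
  all (fun a => a.2 != 0%R) s && sorted separated s.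

Lemma level_connect_sym h : connect_sym (level_edge h).
Proof.
apply: sym_connect_sym => u v; rewrite /level_edge [in RHS]e_sym.
by have [euv|//] := boolP (e u v); rewrite rhoK.
Qed.

Lemma level_connect_le h h' u v : (h <= h')%N ->
  connect (level_edge h) u v -> connect (level_edge h') u v.
Proof.
move=> le_h; apply: connect_sub => {}u {}v /andP[euv le_uv]; apply: connect1.
by rewrite /level_edge euv (leq_trans le_uv).
Qed.

Section Syllables.
Variables (Q : groupType) (y : V -> Q).
Hypothesis yK : forall u v, e u v -> y u ^+ (p ^ K u v) = y v ^+ (p ^ K v u).

Definition syl_prod (s : seq (V * int)) : Q :=
  \prod_(a <- s) expgz (y a.1) a.2.

(** Each edge of the path identifies powers of its two generators of valuation at most h, hence also
    those of valuation h. The subtraction is not truncated on a nontrivial path, as [rho] is then at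
    most h at its vertices. *)
Lemma level_power h u v : connect (level_edge h) u v ->
  y u ^+ (p ^ (h - rho u)) = y v ^+ (p ^ (h - rho v)).
Proof.
case/connectP=> s; elim: s u => [|w s IHs] u /=; first by move=> _ ->.
case/andP=> /andP[euw le_h] s_path v_last; rewrite -(IHs _ s_path v_last).
have eq_uw := rhoK euw.
have -> : (h - rho u = K u w + (h - (rho u + K u w)))%N by lia.
have -> : (h - rho w = K w u + (h - (rho u + K u w)))%N by lia.
by rewrite !expnD !expgnA yK.
Qed.

(** With h the level of the syllable, y_w^n is a power of y_w^(p^(h - rho_w)), which [level_power]
    identifies with a power of y_v. *)
Lemma level_merge v w n : n != 0%R ->
  connect (level_edge (level (w, n))) v w ->
  exists n' : int, expgz (y w) n = expgz (y v) n'.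
Proof.
move=> n0 vw; have [n1 eq_n _] := p_part_split p_pr n0.
have := level_power vw; rewrite {2}/level /= addKn => eq_vw.
by eexists; rewrite [in LHS]eq_n -expgzX -eq_vw expgzX.
Qed.

(** If the new syllable is not separated from the head, the one of higher level is rewritten at the
    vertex of the other and the two merge; the recursion continues with a shorter tail. *)
Lemma reduced_cons v n s : reduced s ->
  exists2 s', reduced s' & expgz (y v) n * syl_prod s = syl_prod s'.
Proof.
elim: s v n => [|[w k] s IHs] v n red_s; have [->|n0] := eqVneq n 0%R.
- by exists [::] => //; rewrite expgz0 mul1g.
- exists [:: (v, n)]; first by rewrite /reduced /= n0.
  by rewrite /syl_prod big_seq1 big_nil mulg1.
- by exists ((w, k) :: s) => //; rewrite expgz0 mul1g.
have [/= k0 red_s'] : k != 0%R /\ reduced s.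
  move: red_s; rewrite /reduced /= => /andP[/andP[-> ->]].
  by case: (s) => //= a t /andP[_ ->].
have [sep|] := boolP (separated (v, n) (w, k)).
  exists ((v, n) :: (w, k) :: s); last by rewrite /syl_prod !big_cons.
  by move: red_s; rewrite /reduced /= n0 sep.
rewrite negbK /= /syl_prod big_cons /= => conn.
have [le_vw|/ltnW le_wv] := leqP (level (v, n)) (level (w, k)).
  rewrite (maxn_idPr le_vw) in conn.
  have [n' ->] := level_merge k0 conn.
  by rewrite mulgA -expgzD; exact: IHs.
rewrite (maxn_idPl le_wv) level_connect_sym in conn.
have [n' ->] := level_merge n0 conn.
by rewrite mulgA -expgzD; exact: IHs.
Qed.

Lemma reduced_word (m : V -> int) (w : word V) :
  exists2 s, reduced s & eval_word (fun v => expgz (y v) (m v)) w = syl_prod s.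
Proof.
elim: w => [|[v b] w [s red_s IHw]].
  by exists [::] => //; rewrite /eval_word /syl_prod !big_nil.
have [s' red_s' eq_s'] := reduced_cons v (if b then - m v else m v)%R red_s.
exists s' => //; rewrite -eq_s' (eval_word_cat _ [:: _]) IHw; congr (_ * _).
by rewrite /eval_word big_seq1 /= {eq_s'}; case: b; rewrite ?expgzN.
Qed.

End Syllables.
End Levels.

(** * The path representation *)

Section Unitriangular.
Variables (p n : nat).
Hypothesis p_pr : prime p.
Local Notation mx := 'M['F_p]_n.+1.
Local Open Scope ring_scope.

Lemma pchar_mx : p \in [pchar mx].
Proof. exact: (rmorph_pchar (@scalar_mx _ n.+1)) (pchar_Fp p_pr). Qed.

Lemma exprD1_pchar (A : mx) a : (1 + A) ^+ (p ^ a)%N = 1 + A ^+ (p ^ a)%N.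
Proof.
elim: a => [|a IHa]; first by rewrite !expr1.
rewrite expnSr !exprM IHa -!(pFrobenius_autE pchar_mx).
rewrite pFrobenius_autD_comm ?pFrobenius_aut1 //.
exact: commr_sym (commr1 _).
Qed.

Definition unitriangular (A : mx) : Prop :=
  forall x y : 'I_n.+1, (y <= x)%N -> A x y = (x == y)%:R.

Lemma unitriangular1 : unitriangular 1.
Proof. by move=> x y _; rewrite mxE. Qed.

Lemma unitriangularM A B : unitriangular A -> unitriangular B ->
  unitriangular (A * B).
Proof.
move=> trA trB x y le_yx; rewrite mxE (bigD1 x) //= trA // eqxx mul1r.
rewrite trB // big1 ?addr0 // => z zx.
have [le_zx|lt_xz] := leqP z x; first by rewrite trA // eq_sym (negPf zx) mul0r.
rewrite trB 1?(leq_trans le_yx) 1?ltnW //.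
case: eqP => [eq_zy|_]; last by rewrite mulr0.
by move: le_yx; rewrite -eq_zy leqNgt lt_xz.
Qed.

(** A - 1 is strictly upper triangular, so its power of exponent p^(n+1) vanishes, and Frobenius
    transfers this to A. *)
Lemma unitriangular_torsion A : unitriangular A -> A ^+ (p ^ n.+1)%N = 1.
Proof.
move=> trA; pose N := A - 1.
have powN k (x y : 'I_n.+1) : (y < x + k)%N -> (N ^+ k) x y = 0.
  elim: k x y => [|k IHk] x y lt_y.
    rewrite expr0 mxE; case: eqP => // eq_xy.
    by move: lt_y; rewrite eq_xy addn0 ltnn.
  rewrite exprSr mxE big1 // => z _.
  have [lt_z|le_z] := ltnP z (x + k); first by rewrite IHk // mul0r.
  have le_yz : (y <= z)%N by lia.
  by rewrite !mxE trA // subrr mulr0.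
have N0 : N ^+ (p ^ n.+1)%N = 0.
  apply/matrixP=> x y; rewrite powN ?mxE //.
  have := ltn_expl n.+1 (prime_gt1 p_pr); have := ltn_ord y.
  by move=> lt_y lt_n; apply: (leq_trans lt_y); rewrite (leq_trans (ltnW lt_n)) ?leq_addl.
by rewrite -[A](subrKC 1) exprD1_pchar -/N N0 addr0.
Qed.

End Unitriangular.

Section PathRepresentation.
Variables (p : nat) (V : finType) (e : rel V) (rho : V -> nat) (K : V -> V -> nat).
Hypothesis p_pr : prime p.
Hypothesis e_sym : symmetric e.
Hypothesis rhoK : forall u v, e u v -> (rho u + K u v = rho v + K v u)%N.
Variables (a0 : V * int) (s : seq (V * int)).
Hypothesis red_s : reduced p e rho K s.

(** The path has vertices 0, ..., L, and step t leads from t to t + 1. Syllable i owns the steps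
    from [pos i] up to but excluding [pos i.+1]; [seg t] is the owner of step t. *)
Let widths := [seq (p ^ level p rho a)%N | a <- s].
Let L := sumn widths.
Let pos i := sumn (take i widths).
Let seg t := reshape_index widths t.
Let syl i := nth a0 s i.

Definition step_ok (u : V) (t : nat) : bool :=
  connect (level_edge e rho K (level p rho (syl (seg t)))) (syl (seg t)).1 u.

Definition walk_ok (u : V) (x y : nat) : bool :=
  [forall t : 'I_L, (x <= t < y)%N ==> step_ok u t].

Lemma walk_okP u x y : (y <= L)%N ->
  reflect (forall t, x <= t < y -> step_ok u t)%N (walk_ok u x y).
Proof.
move=> le_yL; apply: (iffP forallP) => [ok t xty|ok t]; last exact/implyP/ok.
have lt_t : (t < L)%N by case/andP: xty => _ /leq_trans; apply.
exact: (implyP (ok (Ordinal lt_t))).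
Qed.

Lemma posS i : (i < size s)%N -> pos i.+1 = (pos i + p ^ level p rho (syl i))%N.
Proof.
move=> lt_i; rewrite /pos (take_nth 0) ?size_map // sumn_rcons.
by rewrite (nth_map a0).
Qed.

Lemma pos_size : pos (size s) = L.
Proof. by rewrite /pos take_oversize ?size_map. Qed.

Lemma pos_le i : (pos i <= L)%N.
Proof. by rewrite /L -(cat_take_drop i widths) sumn_cat leq_addr. Qed.

Lemma seg_bounds t : (t < L)%N ->
  [/\ seg t < size s, pos (seg t) <= t & t < pos (seg t).+1]%N.
Proof.
move=> lt_t; have lt_seg := reshape_indexP lt_t; rewrite size_map in lt_seg.
have := reshape_offsetP lt_t; have := reshape_indexK widths t.
rewrite /flatten_index -/(seg t) -/(pos _) (nth_map a0) // => eq_t lt_off.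
split=> //; first by rewrite -{2}eq_t leq_addr.
by rewrite posS // -{1}eq_t ltn_add2l.
Qed.

Lemma segE i t : (i < size s)%N -> (pos i <= t < pos i.+1)%N -> seg t = i.
Proof.
move=> lt_i /andP[le_t]; rewrite posS // => lt_t.
rewrite -(subnKC le_t); apply: flatten_indexKl.
by rewrite (nth_map a0) // -(ltn_add2l (pos i)) subnKC.
Qed.

Lemma pos_ltS i : (i < size s)%N -> (pos i < pos i.+1)%N.
Proof.
by move=> lt_i; rewrite posS // -addn1 leq_add2l expn_gt0 prime_gt0.
Qed.

(** The two steps around [pos i] belong to consecutive syllables, whose components cannot share the
    vertex u. *)
Lemma boundary u i : (0 < i < size s)%N ->
  ~ (step_ok u (pos i).-1 /\ step_ok u (pos i)).
Proof.
case: i => // i /andP[_ lt_i]; have lt_i' := ltnW lt_i.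
have lt_pos := pos_ltS lt_i'.
rewrite /step_ok (@segE i (pos i.+1).-1) //; last by lia.
rewrite (@segE i.+1) //; last by rewrite leqnn pos_ltS.
case=> conn1 conn2.
have /andP[_ /(sortedP a0)/(_ i lt_i)/negP] := red_s; apply.
apply: connect_trans (level_connect_le (leq_maxl _ _) conn1) _.
rewrite level_connect_sym //.
exact: level_connect_le (leq_maxr _ _) conn2.
Qed.

Lemma walk_no_crossing u i x y : (y <= L)%N -> (0 < i)%N ->
  (x < pos i < y)%N -> ~~ walk_ok u x y.
Proof.
move=> le_y i_gt0 /andP[lt_x lt_y]; apply/negP => /(walk_okP _ _ le_y) ok.
have lt_i : (i < size s)%N.
  rewrite ltnNge; apply/negP => le_i; move: lt_y; rewrite ltnNge /pos.
  by rewrite take_oversize ?size_map // le_y.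
by apply: (@boundary u i); [rewrite i_gt0 | split; apply: ok; lia].
Qed.

(** An admissible walk crosses no boundary, so it fits into one segment. The width of that segment
    is then at least p^(rho_u + K_uv), so the edge belongs to the forest there and v is in the same
    component as u. *)
Lemma walk_edge u v x : e u v -> (x + p ^ (rho u + K u v) <= L)%N ->
  walk_ok u x (x + p ^ (rho u + K u v)) -> walk_ok v x (x + p ^ (rho u + K u v)).
Proof.
move=> euv; set h := (rho u + K u v)%N; set y := (x + _)%N => le_y ok_u.
apply/walk_okP => // t xty.
have [lt_seg le_t lt_t] : [/\ seg t < size s, pos (seg t) <= t & t < pos (seg t).+1]%N.
  by apply: seg_bounds; case/andP: xty => _ /leq_trans; apply.
have := walk_okP _ _ le_y ok_u t xty; rewrite /step_ok => conn.
apply: connect_trans conn _; apply: connect1; rewrite /level_edge euv /=.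
have le_x : (pos (seg t) <= x)%N.
  rewrite leqNgt; apply/negP => lt_x.
  have [seg0|seg_gt0] := posnP (seg t); first by move: lt_x; rewrite seg0 /pos take0.
  have cross : (x < pos (seg t) < y)%N by lia.
  by rewrite (negPf (walk_no_crossing u le_y seg_gt0 cross)) in ok_u.
have le_y' : (y <= pos (seg t).+1)%N.
  rewrite leqNgt; apply/negP => lt_y.
  have cross : (x < pos (seg t).+1 < y)%N by lia.
  by rewrite (negPf (walk_no_crossing u le_y (ltn0Sn _) cross)) in ok_u.
rewrite posS // in le_y'.
by rewrite -(leq_exp2l _ _ (prime_gt1 p_pr)) -/h; lia.
Qed.

Local Notation mx := 'M['F_p]_L.+1.
Local Open Scope ring_scope.

(** For h = p^rho_u this is X_u; the other lengths are needed to express its powers. *)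
Definition shift_mx (u : V) (h : nat) : mx :=
  \matrix_(x, y) ((y == x + h :> nat)%N && walk_ok u x y)%:R.

Lemma shift_mx0 u : shift_mx u 0 = 1.
Proof.
apply/matrixP=> x y; rewrite !mxE addn0 eq_sym -val_eqE /=.
case: eqP => //= eq_xy; suff -> : walk_ok u x y by [].
by apply/forallP => t; apply/implyP; rewrite eq_xy; lia.
Qed.

(** The only possible intermediate point is x + h, and a walk is admissible exactly when its two
    pieces are. If x + h exceeds L, both sides vanish. *)
Lemma shift_mxD u h h' : shift_mx u h * shift_mx u h' = shift_mx u (h + h').
Proof.
apply/matrixP=> x y; rewrite !mxE.
have [lt_h|le_h] := ltnP L (x + h).
  rewrite big1 => [|z _]; last first.
    rewrite !mxE; case: eqP => [eq_z|_]; last by rewrite mul0r.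
    by have := ltn_ord z; rewrite eq_z ltnS leqNgt lt_h.
  case: eqP => //= eq_y; have := ltn_ord y; lia.
rewrite (bigD1 (Ordinal (leq_trans le_h (leqnn _) : (x + h < L.+1)%N))) //=.
rewrite big1 ?addr0 => [|z]; last first.
  rewrite -val_eqE /= => /negPf z_neq; rewrite !mxE z_neq /=.
  by rewrite mul0r.
rewrite !mxE /= eqxx /= addnA; case: eqP => [eq_y|_]; last by rewrite mulr0.
rewrite -natrM mulnb /=; congr (nat_of_bool _)%:R.
have le_yL : (y <= L)%N by rewrite -ltnS.
apply/andP/idP => [[/(walk_okP _ _ le_h) ok1 /(walk_okP _ _ le_yL) ok2]|].
  apply/(walk_okP _ _ le_yL) => t /andP[le_t lt_t].
  by have [lt|le] := ltnP t (x + h); [apply: ok1 | apply: ok2]; rewrite ?le_t ?le ?lt.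
move=> /(walk_okP _ _ le_yL) ok; split; [apply/(walk_okP _ _ le_h)|apply/(walk_okP _ _ le_yL)];
  by move=> t /andP[le_t lt_t]; apply: ok; lia.
Qed.

Lemma shift_mxX u h n : shift_mx u h ^+ n = shift_mx u (h * n)%N.
Proof.
elim: n => [|n IHn]; first by rewrite muln0 shift_mx0.
by rewrite exprS IHn shift_mxD mulnS.
Qed.

Lemma shift_mx_edge u v : e u v ->
  shift_mx u (p ^ (rho u + K u v))%N = shift_mx v (p ^ (rho v + K v u))%N.
Proof.
move=> euv; rewrite -(rhoK euv); apply/matrixP=> x y; rewrite !mxE.
case: eqP => //= eq_y; congr (nat_of_bool _)%:R.
have le_yL : (x + p ^ (rho u + K u v) <= L)%N by rewrite -eq_y -ltnS.
rewrite eq_y; apply/idP/idP; first exact: walk_edge.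
by rewrite (rhoK euv) in le_yL *; apply: walk_edge; rewrite // e_sym.
Qed.

Definition gen_mx (u : V) : mx := 1 + shift_mx u (p ^ rho u).

Lemma gen_mx_unitriangular u : unitriangular (gen_mx u).
Proof.
move=> x y le_yx; rewrite !mxE.
have xp : (0 < p ^ rho u)%N by rewrite expn_gt0 prime_gt0.
have [eq_y|_] /= := eqVneq (y : nat) (x + p ^ rho u)%N; last by rewrite addr0.
by move: le_yx; rewrite eq_y -{2}[x : nat]addn0 leq_add2l leqNgt xp.
Qed.

Lemma gen_mx_edge u v : e u v ->
  gen_mx u ^+ (p ^ K u v)%N = gen_mx v ^+ (p ^ K v u)%N.
Proof.
move=> euv; rewrite /gen_mx !(exprD1_pchar p_pr) !shift_mxX -!expnD.
by rewrite (shift_mx_edge euv).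
Qed.

(** Writing n = p^a m with m prime to p, Frobenius gives (1 + X)^n = (1 + X^(p^a))^m. Every term
    moves forward along admissible walks, and a move by exactly one unit p^(rho_u + a) has
    coefficient m, nonzero in F_p. *)
Lemma gen_mxX_entry u n x y : (0 < n)%N ->
  ((gen_mx u ^+ n) x y != 0 -> x = y \/ (x < y)%N /\ walk_ok u x y) /\
  ((y = x + p ^ (rho u + logn p n) :> nat)%N -> walk_ok u x y ->
     (gen_mx u ^+ n) x y != 0).
Proof.
move=> n_gt0; have [m cop_m eq_n] := pfactor_coprime p_pr n_gt0.
set a := logn p n in eq_n *.
have -> : (gen_mx u ^+ n) x y =
    \sum_(i < m.+1) ((y == x + p ^ (rho u + a) * i :> nat)%N && walk_ok u x y)%:R
       *+ 'C(m, i).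
  rewrite {1}eq_n mulnC exprM /gen_mx (exprD1_pchar p_pr) addrC exprD1n summxE.
  by apply: eq_bigr => i _; rewrite mulmxnE !shift_mxX -expnD mxE.
have pX : (0 < p ^ (rho u + a))%N by rewrite expn_gt0 prime_gt0.
split=> [nz|eq_y ok].
  have [->|xy] := eqVneq x y; [by left | right].
  have [ok|nok] := boolP (walk_ok u x y); last first.
    by move: nz; rewrite big1 ?eqxx // => i _; rewrite (negPf nok) andbF mul0rn.
  split=> //; have [//|lt_y|/ord_inj eq_xy] := ssrnat.ltngtP x y; last first.
    by rewrite eq_xy eqxx in xy.
  move: nz; rewrite big1 ?eqxx // => i _; case: eqP => [eq_y|_]; last by rewrite mul0rn.
  by move: lt_y; rewrite eq_y ltnNge leq_addr.
have m_gt0 : (0 < m)%N.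
  by case: m cop_m {eq_n} => // /eqP; rewrite gcdn0 => p1; move: p_pr; rewrite p1.
rewrite (bigD1 (inord 1)) //= inordK ?ltnS // muln1 eq_y eqxx -eq_y ok /= big1.
  rewrite addr0 bin1 -(dvdn_pcharf (pchar_Fp p_pr)).
  by rewrite -prime_coprime.
move=> i; rewrite -val_eqE /= inordK ?ltnS // => i1.
case: eqP => [|_]; last by rewrite mul0rn.
rewrite eq_y => /addnI/eqP; rewrite -{1}[(p ^ _)%N]muln1 eqn_pmul2l // eq_sym.
by rewrite (negPf i1).
Qed.

Lemma gen_mx_unit u : gen_mx u \is a GRing.unit.
Proof.
rewrite -(@unitrX_pos _ _ (p ^ L.+1)) ?expn_gt0 ?prime_gt0 //.
by rewrite unitriangular_torsion ?unitr1 //; exact: gen_mx_unitriangular.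
Qed.

Definition gen_unit u : {unit mx} := FinRing.unit mx (gen_mx_unit u).

Lemma gen_unit_edge u v : e u v ->
  (gen_unit u ^+ (p ^ K u v) = gen_unit v ^+ (p ^ K v u))%g.
Proof. by move=> euv; apply: val_inj; rewrite !FinRing.val_unitX gen_mx_edge. Qed.

Lemma unit_torsion (g : {unit mx}) : unitriangular (val g) ->
  (g ^+ (p ^ L.+1) = 1)%g.
Proof.
by move=> tri_g; apply: val_inj; rewrite FinRing.val_unitX unitriangular_torsion.
Qed.

Lemma unitriangular_unitX (g : {unit mx}) n : unitriangular (val g) ->
  unitriangular (val (g ^+ n)%g).
Proof.
move=> tri_g; elim: n => [|n IHn]; first exact: unitriangular1.
by rewrite expgS; apply: unitriangularM.
Qed.

Lemma unitriangular_unit_expgz (g : {unit mx}) n : unitriangular (val g) ->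
  unitriangular (val (expgz g n)).
Proof.
have inv_tri (h : {unit mx}) : unitriangular (val h) -> unitriangular (val (h^-1)%g).
  (* Torsion makes the inverse a positive power, so closure under products suffices. *)
  move=> tri_h; have -> : (h^-1 = h ^+ (p ^ L.+1).-1)%g.
    apply: mulg1_eq; rewrite -expgS prednK ?unit_torsion //.
    by rewrite expn_gt0 prime_gt0.
  exact: unitriangular_unitX.
by case: n => n tri_g /=; [|apply: inv_tri]; exact: unitriangular_unitX.
Qed.

Lemma gen_word_torsion (c : V -> int) (w : word V) :
  (eval_word (fun v => expgz (gen_unit v) (c v)) w ^+ (p ^ L.+1) = 1)%g.
Proof.
apply: unit_torsion; elim: w => [|[v b] w IHw].
  by rewrite /eval_word big_nil; exact: unitriangular1.
rewrite (eval_word_cat _ [:: _]); apply: unitriangularM => //.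
rewrite /eval_word big_seq1 /=.
have tri c' : unitriangular (val (expgz (gen_unit v) c')).
  exact/unitriangular_unit_expgz/gen_mx_unitriangular.
by case: b; [have := tri (- c v); rewrite expgzN | apply: tri].
Qed.

Lemma gen_unit_entry u (n : int) x y : n != 0 ->
  (val (expgz (gen_unit u) n) x y != 0 -> x = y \/ (x < y)%N /\ walk_ok u x y) /\
  ((y = x + p ^ level p rho (u, n) :> nat)%N -> walk_ok u x y ->
     val (expgz (gen_unit u) n) x y != 0).
Proof.
move=> n0.
have [N N_gt0 [logN ->]] : exists2 N : nat, (0 < N)%N &
    logn p N = logn p `|n| /\ expgz (gen_unit u) n = (gen_unit u ^+ N)%g.
  case: n n0 => n n0; first by exists n => //; lia.
  have pL : (0 < p ^ L.+1)%N by rewrite expn_gt0 prime_gt0.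
  have pL1 : (0 < (p ^ L.+1).-1)%N by have := ltn_expl L.+1 (prime_gt1 p_pr); lia.
  (* Modulo the torsion exponent p^(L+1), this represents -(n+1), and the factor p^(L+1) - 1 is
     prime to p, so the valuation is unchanged. *)
  exists (n.+1 * (p ^ L.+1).-1)%N; first by rewrite muln_gt0.
  split.
    rewrite lognM // [logn p (_.-1)]lognE [(p %| _)%N](_ : _ = false) ?andbF ?addn0 //.
    apply: contraTF (prime_gt1 p_pr) => dvd_p; rewrite -leqNgt dvdn_leq //.
    by rewrite -(dvdn_addr _ dvd_p) addn1 prednK // expnS dvdn_mulr.
  rewrite /=; apply: mulg1_eq; rewrite -expgnDr -mulnS prednK // mulnC expgnA.
  rewrite unit_torsion ?expg1n //; exact: gen_mx_unitriangular.
rewrite FinRing.val_unitX /level /= -logN; exact: gen_mxX_entry.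
Qed.

Lemma walk_segment i : (i < size s)%N -> walk_ok (syl i).1 (pos i) (pos i.+1).
Proof.
move=> lt_i; apply/(walk_okP _ _ (pos_le _)) => t xty.
by rewrite /step_ok (segE lt_i xty) connect0.
Qed.

(* Each factor moves along the path at most to the end of the current segment,
   so all factors must traverse their own segment. *)
Lemma suffix_entry k : (k <= size s)%N ->
  let P := val (syl_prod gen_unit (drop (size s - k) s)) : mx in
  (forall x : 'I_L.+1, (x < pos (size s - k))%N -> P x ord_max = 0) /\
  P (inord (pos (size s - k))) ord_max != 0.
Proof.
elim: k => [_|k IHk lt_k] /=.
  rewrite subn0 drop_size /syl_prod big_nil /= pos_size.
  rewrite (_ : inord L = ord_max); last by apply: val_inj; rewrite /= inordK.
  split=> [x lt_x|]; last by rewrite mxE eqxx oner_neq0.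
  by rewrite mxE; case: eqP => // eq_x; move: lt_x; rewrite eq_x ltnn.
have {IHk} /= [P0 P1] := IHk (ltnW lt_k).
set i := (size s - k.+1)%N; have lt_i : (i < size s)%N by rewrite /i; lia.
have eq_i : (size s - k)%N = i.+1 by rewrite /i; lia.
rewrite eq_i in P0 P1; rewrite (drop_nth a0) // /syl_prod big_cons -/(syl_prod _ _).
set P := syl_prod _ _ in P0 P1 *; set U := expgz _ _.
have nz_i : (syl i).2 != 0.
  by have /andP[/(all_nthP a0)/(_ i lt_i)] := red_s.
have entry := gen_unit_entry (syl i).1 _ _ nz_i; rewrite -/U in entry.
have mulE x : val (U * P)%g x ord_max = \sum_w val U x w * val P w ord_max.
  by rewrite FinRing.val_unitM mxE.
have leL (w : 'I_L.+1) : (w <= L)%N by rewrite -ltnS.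
have lt_pos := pos_ltS lt_i.
split=> [x lt_x|]; rewrite mulE.
  (* The later factors vanish on points before [pos i.+1], and a walk from before [pos i] to a point
     beyond it would cross that boundary. *)
  rewrite big1 // => w _; have [lt_w|le_w] := ltnP w (pos i.+1).
    by rewrite P0 ?mulr0.
  apply/eqP; rewrite mulf_eq0; apply/orP; left; apply/negPn/negP => /(entry x w).1.
  case=> [eq_xw|[lt_xw ok]]; first by move: lt_x; rewrite eq_xw; lia.
  have i_gt0 : (0 < i)%N by case: (i) lt_x => //; rewrite /pos take0.
  have cross : (x < pos i < w)%N by lia.
  by rewrite (negPf (walk_no_crossing _ (leL w) i_gt0 cross)) in ok.
(* Only the middle point [pos i.+1] contributes: earlier ones are killed by the induction
   hypothesis, later ones lie across the boundary. *)
rewrite (bigD1 (inord (pos i.+1))) //= big1 ?addr0.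
  rewrite mulf_neq0 //; apply: (entry _ _).2; rewrite !inordK ?ltnS ?pos_le //.
    exact: posS.
  exact: walk_segment.
move=> w; rewrite -val_eqE /= inordK ?ltnS ?pos_le // => w_neq.
have [lt_w|le_w] := ltnP w (pos i.+1); first by rewrite P0 ?mulr0.
apply/eqP; rewrite mulf_eq0; apply/orP; left.
apply/negPn/negP => /(entry _ w).1.
case=> [eq_w|[_ ok]].
  by move: le_w; rewrite -eq_w inordK ?ltnS ?pos_le // leqNgt lt_pos.
rewrite inordK ?ltnS ?pos_le // in ok.
have cross : (pos i < pos i.+1 < w)%N by rewrite lt_pos /=; lia.
by rewrite (negPf (walk_no_crossing _ (leL w) (ltn0Sn _) cross)) in ok.
Qed.

(** The entry from 0 to L is nonzero, and L is positive, whereas the identity has 0 there. *)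
Lemma syl_prod_gen_unit_neq1 : s != [::] -> syl_prod gen_unit s <> 1%g.
Proof.
rewrite -size_eq0 -lt0n => s_gt0 prod1.
have [_] := suffix_entry (leqnn _); rewrite subnn drop0 prod1 /pos take0 mxE.
have [eq0 _|_] := eqVneq (inord (sumn [::]) : 'I_L.+1) ord_max; last by rewrite eqxx.
have /= L0 := congr1 (@nat_of_ord _) eq0; rewrite inordK // in L0.
have := pos_ltS s_gt0; have := pos_le 1; rewrite -L0; lia.
Qed.

End PathRepresentation.

(** * Tree groups *)

Section PresentationWeights.
Variables (X : choiceType) (R : set (word X * word X)) (q : X -> int).

Let weight (w : word X) : int :=
  (\sum_(a <- w) (if a.2 then - q a.1 else q a.1))%R.

(** The weighted exponent sum is unchanged by cancellation and by the relations; this is the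
    homomorphism to Z, read on words. *)
Lemma gen_pow_weight (x y : X) (a b : int) :
  (forall r, R r -> exists z t (i j : int),
     r = (gen_pow z i, gen_pow t j) /\ (q z * i = q t * j)%R) ->
  expgz (pres_gen R x) a = expgz (pres_gen R y) b -> (q x * a = q y * b)%R.
Proof.
move=> q_rel; rewrite -!of_word_gen_pow => /of_wordP cong_ab.
have weight_pow z n : weight (gen_pow z n) = (q z * n)%R.
  rewrite /weight /gen_pow big_nseq iter_addr_0 -mulr_natr natz.
  by case: n => n; rewrite ?NegzE ?mulrN ?mulNr /= ?abszN.
rewrite -!weight_pow; elim: cong_ab => [//|//|u v w _ -> _ -> //|u v z d|u v r Rr].
  by rewrite /weight !big_cat !big_cons big_nil /=; case: d => /=; lia.
have [z [t [i [j [-> eq_ij]]]]] := q_rel _ Rr.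
rewrite /weight !big_cat /= -!/(weight _) !weight_pow eq_ij //.
Qed.

End PresentationWeights.

Lemma normal_closure_normal (G : groupType) (S : set G) :
  normal_subgroup (normal_closure S).
Proof.
split=> [M [[M1 _ _ _] _] //|x y Nx Ny M MS|x Nx M MS|x y Nx M MS];
  have [[M1 MM MV MJ] _] := MS.
- by apply: MM; [exact: Nx | exact: Ny].
- by apply: MV; exact: Nx.
- by apply: MJ; exact: Nx.
Qed.

Lemma normal_closure_sub (G : groupType) (S N : set G) :
  normal_subgroup N -> S `<=` N -> normal_closure S `<=` N.
Proof. by move=> nN SN g; apply. Qed.

Lemma sub_normal_closure (G : groupType) (S : set G) : S `<=` normal_closure S.
Proof. by move=> g Sg M [_]; apply. Qed.

Section TreeGroup.
Variables (p : nat) (p_pr : prime p) (V : finType) (e : rel V).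
Variables (lab : V -> V -> int) (k l : V -> V -> int).
Hypothesis e_sym : symmetric e.
Hypothesis e_irr : irreflexive e.
Hypothesis lab_neq0 : forall u v, e u v -> lab u v <> 0%R.
Hypothesis klP : forall u v, u != v ->
  meet_exponents (gbs_gen e lab u) (gbs_gen e lab v) (k u v) (l u v).
Variables (rho : V -> nat) (m c : V -> int).
Hypothesis pNm : forall v, ~~ (p %| `|m v|)%N.
Hypothesis bezout_m : (\sum_v c v * m v = 1)%R.
Hypothesis weight_lab : forall u v, e u v ->
  ((p ^ rho u)%N%:Z * m u * lab u v = (p ^ rho v)%N%:Z * m v * lab v u)%R.

Let G := gbs_group e lab.
Let x : V -> G := gbs_gen e lab.
Let K u v := logn p `|lab u v|.

Lemma gbs_weight u v (a b : int) : expgz (x u) a = expgz (x v) b ->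
  ((p ^ rho u)%N%:Z * m u * a = (p ^ rho v)%N%:Z * m v * b)%R.
Proof.
apply: (gen_pow_weight (q := fun w => ((p ^ rho w)%N%:Z * m w)%R)).
move=> _ [w [z [ewz ->]]]; exists w, z, (lab w z), (lab z w); split=> //.
exact: weight_lab.
Qed.

Lemma gbs_rel u v : e u v -> expgz (x u) (lab u v) = expgz (x v) (lab v u).
Proof.
move=> euv; rewrite -!of_word_gen_pow; apply/of_wordP.
have := @Wrel _ (gbs_relations e lab) [::] [::] (gen_pow u (lab u v), gen_pow v (lab v u)).
by rewrite /= !cats0; apply; exists u, v.
Qed.

Lemma k_neq0 u v : u != v -> k u v != 0%R.
Proof. by move=> /klP[/eqP]. Qed.

Lemma l_neq0 u v : u != v -> l u v != 0%R.
Proof. by move=> /klP[_ /eqP]. Qed.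

Lemma weight_kl u v : u != v ->
  ((p ^ rho u)%N%:Z * m u * k u v = (p ^ rho v)%N%:Z * m v * l u v)%R.
Proof. by move=> /klP[_ _ eq_kl _ _]; exact: gbs_weight. Qed.

Lemma edge_neq u v : e u v -> u != v.
Proof. by apply: contraTneq => ->; rewrite e_irr. Qed.

Lemma weight_neq0 u : ((p ^ rho u)%N%:Z * m u)%R != 0%R.
Proof.
rewrite mulf_neq0 //; first by rewrite eqz_nat -lt0n expn_gt0 prime_gt0.
by apply: contraNneq (pNm u) => ->.
Qed.

(** The edge element lies in the intersection, which x_u^k generates. Nonzero weights determine
    exponents, so the same n serves at both ends. *)
Lemma lab_multiple u v : e u v ->
  exists n, lab u v = (k u v * n)%R /\ lab v u = (l u v * n)%R.
Proof.
move=> euv; have uv := edge_neq euv; have [_ _ _ eq_k _] := klP uv.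
have : (cyclic_subgroup (x u) `&` cyclic_subgroup (x v)) (expgz (x u) (lab u v)).
  by split; [exists (lab u v) | rewrite gbs_rel //; exists (lab v u)].
rewrite eq_k => -[n _]; rewrite -expgzM => eq_lab.
have labE : lab u v = (k u v * n)%R.
  by apply: (mulfI (weight_neq0 u)); apply/esym/gbs_weight.
exists n; split=> //; apply: (mulfI (weight_neq0 v)).
by rewrite -weight_lab // labE !mulrA weight_kl.
Qed.

Lemma rhoK u v : e u v -> (rho u + K u v = rho v + K v u)%N.
Proof.
move=> euv; have evu : e v u by rewrite e_sym.
have [_ [_ [_ [[-> _] _ _ _ _]]]] := pair_arith p_pr (introN eqP (lab_neq0 euv))
  (introN eqP (lab_neq0 evu)) (pNm u) (pNm v) (weight_lab euv).
by [].
Qed.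

(** The map sends x_v to f_v^m_v. Both sides of an edge relation then have the exponent p^K times
    one common integer k' l' g d, so the relation between the p-parts suffices. *)
Lemma gbs_hom (H : groupType) (f : V -> H) :
  (forall u v, e u v -> f u ^+ (p ^ K u v) = f v ^+ (p ^ K v u)) ->
  exists phi : {ghom G -> H},
    forall w, phi (of_word _ w) = eval_word (fun v => expgz (f v) (m v)) w.
Proof.
move=> fK; apply: pres_hom => _ [u [v [euv ->]]] /=; rewrite !eval_gen_pow.
have evu : e v u by rewrite e_sym.
have [k' [l' [g [_ [_ eq_uv] [_ eq_vu] mu mv]]]] := pair_arith p_pr
  (introN eqP (lab_neq0 euv)) (introN eqP (lab_neq0 evu)) (pNm u) (pNm v)
  (weight_lab euv).
set d := gcdz _ _ in eq_uv eq_vu.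
rewrite -!expgzM -eq_uv -eq_vu -/(K u v) -/(K v u).
have -> : (m u * (k' * (p ^ K u v)%N%:Z * d) = (p ^ K u v)%N%:Z * (k' * l' * g * d))%R.
  by rewrite mu; ring.
have -> : (m v * (l' * (p ^ K v u)%N%:Z * d) = (p ^ K v u)%N%:Z * (k' * l' * g * d))%R.
  by rewrite mv; ring.
by rewrite -!expgzX fK.
Qed.

Let S := \bigcup_(uv in [set uv : V * V | uv.1 != uv.2])
  S_pair p (x uv.1) (x uv.2) (k uv.1 uv.2) (l uv.1 uv.2).

(** In G/N all elements are killed by p^n, and there the relators of S follow from the pair
    relation. *)
Lemma S_sub_p_index (N : set G) n :
  normal_subgroup N -> has_index N (p ^ n)%N -> S `<=` N.
Proof.
move=> nN indN g [[u v] /= uv Sg].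
have [Q [pi [piP pi_surj]]] := quotient_exists nN.
apply/piP; have [_ _ eq_kl _ _] := klP uv.
apply: (@S_pair_p_torsion p Q (pi (x u)) (pi (x v)) (k u v) (l u v) (rho u) (rho v)
  (m u) (m v) n p_pr (k_neq0 uv) (l_neq0 uv) (pNm u) (pNm v) (weight_kl uv)).
- by rewrite -!gmulf_expgz eq_kl.
- by move=> h; have [h' <-] := pi_surj h; rewrite -gmulfXn; apply/piP; apply: expg_index.
- by rewrite S_pair_image; exists g.
Qed.

Lemma normal_closure_sub_p_index (N : set G) n :
  normal_subgroup N -> has_index N (p ^ n)%N -> normal_closure S `<=` N.
Proof. move=> nN indN; exact: normal_closure_sub nN (S_sub_p_index nN indN). Qed.

(** If g survives in Q = G / <<S>>, its image has a nonempty reduced word, whose path representation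
    gives a finite p-quotient of G in which g is nontrivial. *)
Lemma Np_omega_sub : Np_omega p `<=` normal_closure S.
Proof.
move=> g Np_g; have nN := normal_closure_normal S.
have [Q [pi [piP pi_surj]]] := quotient_exists nN.
have S1 u v : u != v -> S_pair p (pi (x u)) (pi (x v)) (k u v) (l u v) `<=` [set 1].
  move=> uv; rewrite S_pair_image => _ [h Sh <-]; apply/piP.
  by apply: (@sub_normal_closure _ S); exists (u, v).
have [y [ym yK]] := p_roots p_pr pNm bezout_m k_neq0 l_neq0 weight_kl S1.
(* The labels are n times the pair exponents, so the edge relation is the pair relation raised to
   the p-part of n. *)
have yKlab u v : e u v -> y u ^+ (p ^ K u v) = y v ^+ (p ^ K v u).
  move=> euv; have uv := edge_neq euv; have [n [eq_uv eq_vu]] := lab_multiple euv.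
  have n0 : n != 0%R.
    by apply/eqP => n0; apply: (lab_neq0 euv); rewrite eq_uv n0 mulr0.
  have := k_neq0 uv; have := l_neq0 uv => l0 k0.
  rewrite /K eq_uv eq_vu !abszM !lognM ?absz_gt0 // !expnD !expgnA yK //.
apply/piP; pose w := repr g.
have pi_g : pi g = eval_word (fun v => expgz (y v) (m v)) w.
  rewrite -[g]of_word_repr -of_word_eval eval_word_morph.
  by rewrite /eval_word; apply: eq_bigr => -[v b] _ /=; rewrite -ym.
have [s red_s eq_s] := reduced_word p_pr e_sym rhoK yKlab m w.
have [s0|s_neq0] := eqVneq s [::]; first by rewrite pi_g eq_s s0 /syl_prod big_nil.
have [a0 _] : exists a0 : V * int, True by case: (s) s_neq0 => // a; exists a.
pose f := gen_unit e rho K p_pr a0 s.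
have fK u v : e u v -> f u ^+ (p ^ K u v) = f v ^+ (p ^ K v u).
  exact: (gen_unit_edge p_pr e_sym rhoK a0 red_s).
have [phi phiE] := gbs_hom fK.
have phi_tors h : phi h ^+ (p ^ (sumn [seq (p ^ level p rho a)%N | a <- s]).+1) = 1.
  by rewrite -[h]of_word_repr phiE; exact: gen_word_torsion.
have [n ind_ker] : exists n, has_index [set h | phi h = 1] (p ^ n)%N.
  by apply: ker_p_index => // h; eexists; exact: phi_tors.
(* The kernel of [phi] has p-power index, so it contains the normal closure of S. *)
have ker_phi h : pi h = 1 -> phi h = 1.
  by move/piP => Nh; have := normal_closure_sub_p_index (hom_kernel_normal phi) ind_ker Nh.
have [psi psiE] := factor_through pi_surj ker_phi.
(* Only the m_v-th powers are known to agree; both elements have p-power order, so their roots of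
   exponent m_v, prime to p, coincide. *)
have psi_y v : psi (y v) = f v.
  apply: (prime_pow_root_unique p_pr (pNm v)).
  - by have [h <-] := pi_surj (y v); rewrite psiE; exact: phi_tors.
  - exact/unit_torsion/gen_mx_unitriangular.
  rewrite -gmulf_expgz ym psiE [phi _]phiE.
  by rewrite /eval_word big_seq1.
(* As g lies in every normal subgroup of p-power index, [phi g] is trivial; but [phi g] is also the
   nontrivial product of the reduced word. *)
case: (@syl_prod_gen_unit_neq1 _ _ _ _ _ p_pr e_sym rhoK a0 s red_s s_neq0).
have phi_g : phi g = 1.
  by apply: (Np_g [set h | phi h = 1]); split; [exact: hom_kernel_normal | exists n].
rewrite -[RHS]phi_g -psiE pi_g eq_s /syl_prod gmulf_prod; apply: eq_bigr => a _.
by rewrite gmulf_expgz psi_y.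
Qed.

End TreeGroup.

Theorem theorem4p5 (p : nat) (p_prime : prime p)
    (V : finType) (e : rel V) (tree_e : is_tree e)
    (lab : V -> V -> int) (lab_neq0 : forall u v, e u v -> lab u v <> 0%R)
    (k l : V -> V -> int)
    (klP : forall u v, u != v ->
       meet_exponents (gbs_gen e lab u) (gbs_gen e lab v) (k u v) (l u v)) :
  @Np_omega (gbs_group e lab) p =
  normal_closure
    (\bigcup_(uv in [set uv : V * V | uv.1 != uv.2])
       S_pair p (gbs_gen e lab uv.1) (gbs_gen e lab uv.2)
         (k uv.1 uv.2) (l uv.1 uv.2)).
Proof.
have [_ e_sym e_irr _ _] := tree_e.
have [rho [m [c [pNm bez w_lab]]]] := gbs_weights p_prime tree_e lab_neq0.
apply/seteqP; split.
  exact: (Np_omega_sub p_prime e_sym e_irr lab_neq0 klP pNm bez w_lab).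
move=> g Ng N [nN [n indN]].
exact: (normal_closure_sub_p_index p_prime klP pNm w_lab nN indN).
Qed.
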